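(* Let $G$ be a finite group satisfying at least one of the following conditions. (1) The center $Z(G)$ has even order. (2) $G$ contains an abelian subgroup of index two. (3) $G$ is nilpotent but not cyclic, of nilpotency class $s$, and no odd prime $p<3\cdot 2^{s-1}-2$ divides $\exp(G)/\exp(Z(G))$. (4) $\mathbf{P}(G)>\frac{11}{32}$, where $\mathbf{P}(G)=\frac{|\{(g,h)\in G\times G\,:\, gh=hg\}|}{|G|^2}$ is the commutativity degree of $G$. Then every geodetic Cayley graph $\mathrm{Cay}(G,\Sigma)$ of $G$ is either a complete graph or a cycle of odd length.
   Context: All generating sets $\Sigma\subseteq G$ satisfy $1\notin\Sigma$ and $\Sigma=\Sigma^{-1}$. The (undirected, simple) Cayley graph $\mathrm{Cay}(G,\Sigma)$ has vertex set $G$ and edge set $\{\{g,ga\} : g\in G,\ a\in\Sigma\}$. A connected graph is geodetic if for each pair of vertices there is a unique shortest path connecting them. $\exp(G)$ denotes the exponent of $G$, i.e. the smallest positive integer $n$ with $g^n=1$ for all $g\in G$. *)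

(* Defs.v *)
From HB Require Import structures.
From mathcomp Require Import all_boot all_order all_algebra all_fingroup.
From mathcomp Require Import all_solvable.

Set Implicit Arguments.
Unset Strict Implicit.
Unset Printing Implicit Defensive.

(* A simple graph on the vertex set T is given by its adjacency relation
   e : rel T, assumed symmetric and irreflexive. *)

Section Graphs.

Variables (T : finType) (e : rel T).
Implicit Types (x y : T) (p q : seq T).

(* The path x :: p has length size p.  MathComp paths may repeat vertices, but
   shortest ones do not. *)
Definition path_from_to x y p : Prop := path e x p /\ last x p = y.

Definition shortest_path x y p : Prop :=
  path_from_to x y p /\ forall q, path_from_to x y q -> size p <= size q.

Definition connected_graph : Prop := forall x y, connect e x y.

Definition geodetic : Prop :=
  connected_graph /\ forall x y, exists! p, shortest_path x y p.

Definition complete_graph : Prop := forall x y, e x y = (x != y).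

(* The graph is isomorphic to the cycle graph on 'I_n, for some odd n >= 3;
   ordS is the successor modulo n. *)
Definition odd_cycle_graph : Prop :=
  exists n : nat, [/\ 2 < n, odd n &
    exists f : 'I_n -> T, bijective f /\
      forall i j, e (f i) (f j) = (j == ordS i) || (i == ordS j)].

End Graphs.

Section Groups.

Local Open Scope group_scope.

Variable G : finGroupType.
Implicit Types (S : {set G}) (g h : G).

Definition generating_set S : Prop :=
  [/\ 1 \notin S, S^-1 = S & <<S>> = [set: G]].

Definition cayley S : rel G := [rel g h | [exists a in S, h == g * a]].

Lemma cayley_sym S : S^-1 = S -> symmetric (cayley S).
Proof.
move=> SV; suff sub g h : cayley S g h -> cayley S h g.
  by move=> g h; apply/idP/idP; apply: sub.
case/exists_inP=> a Sa /eqP->; apply/exists_inP; exists a^-1; last by rewrite mulgK.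
by rewrite -SV inE invgK.
Qed.

Lemma cayley_irr S : 1 \notin S -> irreflexive (cayley S).
Proof.
move=> S1 g; apply/exists_inP=> -[a Sa].
by rewrite -{1}[g]mulg1 (inj_eq (mulgI g)) => /eqP a1; rewrite a1 Sa in S1.
Qed.

Definition commutativity_degree : rat :=
  (#|[set x : G * G | (x.1 * x.2 == x.2 * x.1)%g]|%:R / (#|[set: G]| ^ 2)%:R)%R.

End Groups.

(* Main.v *)
Require Import Defs.
From HB Require Import structures.
From mathcomp Require Import all_boot all_order all_algebra all_fingroup.
From mathcomp Require Import all_solvable.
From mathcomp Require Import all_field all_character zify ring.

(** Shortest words are unique, so two distinct words of length [n] with the same
    product represent an element of length less than [n].  Conjugation by its
    first letter rotates the shortest word of a central element, which is
    therefore a power [a^n] of a generator.  If the centre has even order, this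
    makes a central involution a generator; and a central generator [z] forces
    the generators to be closed under products up to 1 (complete graph) or to be
    [z] and [z^-1] only (cycle).

    Suppose now that the centre has odd order and contains no generator, and let
    [a^d] be a nontrivial central element of minimal length [d > 1]; then [d]
    divides the length of every central element.

    In (3), iterated commutators of generators give [d <= 3 * 2^(s-1) - 2], and
    for a prime [p] dividing [d] a central element [b^n] of maximal [p]-order
    would have [p] dividing [n].

    In (2), [t * u * v = v * u * t] outside the abelian subgroup; it follows that
    the generators outside are involutions inverting the generators inside.

    In (4), character degrees give [#|G'| < 8].  If [G'] is not central, the
    other elements act on it without fixed points, and either the centraliser of
    [G'] is abelian of index two or the commutativity degree is at most 1/3.  If
    [G'] is central then [d = #|G'| = 3], and [v^-1 * u * v] is the unique
    shortest word of [z * u] when [z = [u, v]] generates [G'], so that [u] fails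
    to commute with at most one generator up to inversion. *)

Set Implicit Arguments.
Unset Strict Implicit.
Unset Printing Implicit Defensive.

Local Open Scope group_scope.

(** * Words and their lengths *)

Section Words.

Variables (G : finGroupType) (S : {set G}).
Implicit Types (g h : G) (w u v : seq G).

Definition word w := all [in S] w.
Definition ev w := \prod_(x <- w) x.

Lemma ev_nil : ev [::] = 1. Proof. exact: big_nil. Qed.
Lemma ev_cons x w : ev (x :: w) = x * ev w. Proof. exact: big_cons. Qed.
Lemma ev_cat u v : ev (u ++ v) = ev u * ev v. Proof. exact: big_cat. Qed.
Lemma ev_rcons w x : ev (rcons w x) = ev w * x.
Proof. by rewrite -cats1 ev_cat ev_cons ev_nil mulg1. Qed.
Lemma ev_nseq n x : ev (nseq n x) = x ^+ n.
Proof. by elim: n => [|n IHn]; rewrite ?ev_nil // ev_cons IHn expgS. Qed.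

Lemma cayleyE g h : cayley S g h = (g^-1 * h \in S).
Proof.
apply/exists_inP/idP => [[a Sa /eqP->]|Sgh]; first by rewrite mulKg.
by exists (g^-1 * h); rewrite ?mulKVg.
Qed.

(** A path starting at [g] is the sequence of partial products of a word; [pairmap] with quotients
    of consecutive vertices recovers the letters. *)
Lemma path_scanl g w : path (cayley S) g (scanl *%g g w) = word w.
Proof. by elim: w g => //= x w IHw g; rewrite cayleyE mulKg IHw. Qed.

Lemma last_scanl g w : last g (scanl *%g g w) = g * ev w.
Proof.
by elim: w g => [|x w IHw] g /=; rewrite ?ev_nil ?mulg1 // ev_cons IHw mulgA.
Qed.

Lemma scanl_mulgK g : cancel (scanl *%g g) (pairmap (fun x y => x^-1 * y) g).
Proof. by apply: scanlK => x y /=; rewrite mulKg. Qed.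

Lemma pairmap_mulgK g : cancel (pairmap (fun x y => x^-1 * y) g) (scanl *%g g).
Proof. by apply: pairmapK => x y /=; rewrite mulKVg. Qed.

Hypothesis genS : generating_set S.

Lemma not1S : 1 \notin S. Proof. by case: genS. Qed.
Lemma memSV g : (g^-1 \in S) = (g \in S).
Proof. by case: genS => _ SV _; rewrite -{1}SV mem_invg invgK. Qed.
Lemma memS_neq1 g : g \in S -> g != 1.
Proof. by apply: contraL => /eqP->; exact: not1S. Qed.

(** The boolean quantifier over tuples lets [ex_minn] extract the least length. *)
Lemma word_ex g : exists n, [exists t : n.-tuple G, word t && (ev t == g)].
Proof.
have: g \in <<S>> by case: genS => _ _ ->; rewrite inE.
case/gen_prodgP => n [c Sc ->]; exists n; apply/existsP.
exists (mktuple c); apply/andP; split.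
  by apply/allP=> _ /mapP[i _ ->]; exact: Sc.
by rewrite /ev big_tuple; apply/eqP/eq_bigr => i _; rewrite tnth_mktuple.
Qed.

Definition word_length g := ex_minn (word_ex g).

Lemma wlen_le w : word w -> word_length (ev w) <= size w.
Proof.
rewrite /word_length; case: ex_minnP => n _ nmin Sw; apply: nmin.
by apply/existsP; exists (in_tuple w); rewrite Sw eqxx.
Qed.

Lemma wlen_le_eq g w : word w -> ev w = g -> word_length g <= size w.
Proof. by move=> Sw <-; exact: wlen_le. Qed.

Lemma wlenP g : exists w, [/\ word w, ev w = g & size w = word_length g].
Proof.
rewrite /word_length; case: ex_minnP => n /existsP[t /andP[St /eqP evt]] _.
by exists t; split; rewrite ?size_tuple.
Qed.

Definition geodesic w := word w && (size w <= word_length (ev w)).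

Lemma geod_size w : geodesic w -> size w = word_length (ev w).
Proof. by case/andP=> Sw le; apply/eqP; rewrite eqn_leq le wlen_le. Qed.

Lemma geodP g : exists2 w, geodesic w & ev w = g.
Proof.
by have [w [Sw eg sw]] := wlenP g; exists w; rewrite // /geodesic Sw eg sw /=.
Qed.

Lemma geod_word w : geodesic w -> word w. Proof. by case/andP. Qed.

Lemma word_cat u v : word (u ++ v) = word u && word v.
Proof. exact: all_cat. Qed.

(** A shorter word for one factor would shorten the whole product. *)
Lemma geod_cat u v : geodesic (u ++ v) -> geodesic u /\ geodesic v.
Proof.
case/andP; rewrite word_cat => /andP[Su Sv] le; rewrite /geodesic Su Sv /=.
have [u' [Su' eu su]] := wlenP (ev u); have [v' [Sv' ev' sv]] := wlenP (ev v).
have := leq_trans le (@wlen_le_eq _ (u' ++ v') _ _).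
rewrite word_cat Su' Sv' !ev_cat eu ev' !size_cat => /(_ isT erefl).
have := wlen_le Su; have := wlen_le Sv; rewrite su sv => a b c; split.
  by rewrite -(leq_add2r (size v)) (leq_trans c) // leq_add2l.
by rewrite -(leq_add2l (size u)) (leq_trans c) // leq_add2r.
Qed.

Lemma word_rev_inv w : word w -> word (rev (map invg w)).
Proof.
move=> /allP Sw; rewrite /word all_rev; apply/allP=> _ /mapP[x xw ->].
by rewrite memSV; exact: Sw.
Qed.

Lemma ev_rev_inv w : ev (rev (map invg w)) = (ev w)^-1.
Proof.
elim: w => [|x w IHw] /=; first by rewrite ev_nil invg1.
by rewrite rev_cons ev_rcons IHw ev_cons invMg.
Qed.

Lemma wlenV_le g : word_length g^-1 <= word_length g.
Proof.
have [w [Sw <- <-]] := wlenP g; rewrite -ev_rev_inv.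
by rewrite (leq_trans (wlen_le (word_rev_inv Sw))) // size_rev size_map.
Qed.

Lemma wlenV g : word_length g^-1 = word_length g.
Proof.
by apply/eqP; rewrite eqn_leq wlenV_le -{1}[g]invgK wlenV_le.
Qed.

Lemma wlenM g h : word_length (g * h) <= word_length g + word_length h.
Proof.
have [u [Su <- <-]] := wlenP g; have [v [Sv <- <-]] := wlenP h.
by rewrite -ev_cat -size_cat wlen_le // word_cat Su Sv.
Qed.

Lemma wlen_eq0 g : (word_length g == 0) = (g == 1).
Proof.
apply/eqP/eqP => [l0|->]; last first.
  by apply/eqP; rewrite -leqn0 (wlen_le_eq (w := [::])) // ev_nil.
by have [w [_ eg /eqP]] := wlenP g; rewrite l0 -eg => /nilP->; rewrite ev_nil.
Qed.

Lemma wlen_le1 g : (word_length g <= 1) = (g \in 1 |: S).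
Proof.
apply/idP/setU1P => [|[->|Sg]]; last 2 first.
- by rewrite (eqP (_ : word_length 1 == 0)) // wlen_eq0.
- by apply: (wlen_le_eq (w := [:: g])); rewrite ?ev_cons ?ev_nil ?mulg1 // /word /= Sg.
have [w [Sw <- <-]] := wlenP g.
case: w Sw => [|x [|//]] /=; first by rewrite ev_nil; left.
by rewrite /word /= andbT ev_cons ev_nil mulg1; right.
Qed.

Lemma wlenS g : g \in S -> word_length g = 1%N.
Proof.
move=> Sg; apply/eqP; rewrite eqn_leq wlen_le1 setU1r // lt0n wlen_eq0.
exact: memS_neq1.
Qed.

Hypothesis geoS : geodetic (cayley S).

(** A geodesic word gives a shortest path from [1], because any competing path reads off as a word
    with the same product. Uniqueness of paths thus passes to words. *)
Lemma geod_uniq u v : geodesic u -> geodesic v -> ev u = ev v -> u = v.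
Proof.
case: geoS => _ /(_ 1 (ev u))[p [_ Up]].
have short w : geodesic w -> shortest_path (cayley S) 1 (ev w) (scanl *%g 1 w).
  move=> gw; have [Sw le] := andP gw; split=> [|q [path_q last_q]].
    by split; rewrite ?path_scanl ?last_scanl ?mul1g.
  rewrite size_scanl (leq_trans le) // -(size_pairmap (fun x y => x^-1 * y) 1 q).
  have evq : ev (pairmap (fun x y => x^-1 * y) 1 q) = ev w.
    by rewrite -[LHS]mul1g -last_scanl pairmap_mulgK.
  by rewrite -evq wlen_le // -(path_scanl 1) pairmap_mulgK.
move=> gu gv e; apply: (can_inj (scanl_mulgK 1)).
by rewrite -(Up _ (short _ gu)); apply: Up; rewrite e; exact: short.
Qed.

(** If the length were [size u], both words would be geodesic. *)
Lemma collide u v : word u -> word v -> size u = size v -> ev u = ev v ->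
  u <> v -> word_length (ev u) < size u.
Proof.
move=> Su Sv s e; rewrite ltnNge => ne; apply/negP => le; apply: ne.
by apply: geod_uniq; rewrite // /geodesic ?Su ?Sv -?e -?s.
Qed.

End Words.

(** * Commuting generators and central elements *)

(** Rotation by one letter compares each letter with the next. *)
Lemma cons_eq_rcons (T : eqType) (x : T) s :
  x :: s = rcons s x -> s = nseq (size s) x.
Proof.
elim: s => // y s IHs [<- /IHs {1}->] /=; first by [].
Qed.

Lemma centerTP (G : finGroupType) (z : G) :
  reflect (forall x, commute z x) (z \in 'Z([set: G])).
Proof.
apply: (iffP (centerP [set: G] z)) => [[_ cz] x|cz]; first by apply: cz; rewrite inE.
by split=> [|x _]; [rewrite inE | exact: cz].
Qed.

Section GeodeticCayley.
Variables (G : finGroupType) (S : {set G}).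
Implicit Types (g h z a b : G) (w u v : seq G).
Hypothesis genS : generating_set S.
Hypothesis geoS : geodetic (cayley S).

Notation wlen := (word_length genS).
Notation geod := (geodesic genS).
Notation Z := 'Z([set: G]).

Lemma mem1SV g : (g^-1 \in 1 |: S) = (g \in 1 |: S).
Proof. by rewrite -!(wlen_le1 genS) wlenV. Qed.

Lemma collide2 a b c d : a \in S -> b \in S -> c \in S -> d \in S ->
  a * b = c * d -> a <> c -> a * b \in 1 |: S.
Proof.
move=> Sa Sb Sc Sd e ne; rewrite -(wlen_le1 genS) -ltnS.
have := @collide _ _ genS geoS [:: a; b] [:: c; d].
rewrite /word /ev /= !big_cons !big_nil !mulg1 Sa Sb Sc Sd; apply=> //.
by case.
Qed.

Lemma collide3 a b c a' b' c' : a \in S -> b \in S -> c \in S ->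
  a' \in S -> b' \in S -> c' \in S ->
  a * b * c = a' * b' * c' -> [\/ a <> a', b <> b' | c <> c'] ->
  wlen (a * b * c) < 3.
Proof.
move=> Sa Sb Sc Sa' Sb' Sc' e ne.
have := @collide _ _ genS geoS [:: a; b; c] [:: a'; b'; c'].
rewrite /word /ev /= !big_cons !big_nil !mulg1 !mulgA Sa Sb Sc Sa' Sb' Sc'.
by apply=> // -[e1 e2 e3]; case: ne.
Qed.

Lemma commM a b : a \in S -> b \in S -> commute a b -> a <> b ->
  a * b \in 1 |: S.
Proof. by move=> Sa Sb cab ne; apply: (collide2 (c := b) (d := a)). Qed.

(* The second word for [a * a] is [(a * b) * (b^-1 * a)]. *)
Lemma commute_sq a b : a \in S -> b \in S -> commute a b ->
  a != b -> a != b^-1 -> a * a \in 1 |: S.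
Proof.
move=> Sa Sb cab neq neqV.
have Sab : a * b \in S.
  have /setU1P[/eqP|//] := commM Sa Sb cab (elimN eqP neq).
  by rewrite eq_mulgV1 invgK in neqV; rewrite (negPf neqV).
have SVba : b^-1 * a \in S.
  have SVb : b^-1 \in S by rewrite (memSV genS).
  have nVba : b^-1 <> a by apply/eqP; rewrite eq_sym.
  have /setU1P[/eqP|//] := commM SVb Sa (commute_sym (commuteV cab)) nVba.
  by rewrite -eq_invg_mul invgK eq_sym (negPf neq).
apply: (collide2 (c := a * b) (d := b^-1 * a)) => //; first by rewrite -mulgA mulKVg.
by move/eqP; rewrite -{1}[a]mulg1 (inj_eq (mulgI a)) eq_sym (negPf (memS_neq1 genS Sb)).
Qed.

(** This makes [1 |: S] a subgroup, hence the whole group; completeness of the graph is always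
    reached this way. *)
Definition closedS := forall a b, a \in S -> b \in S -> a * b \in 1 |: S.

Lemma closed_complete : closedS -> complete_graph (cayley S).
Proof.
move=> clS; have grS : group_set (1 |: S).
  apply/group_setP; split=> [|x y]; first exact: setU11.
  move=> /setU1P[->|Sx] /setU1P[->|Sy]; rewrite ?mul1g ?mulg1;
    [exact: setU11 | exact: setU1r | exact: setU1r | exact: clS].
have allS x : x \in 1 |: S.
  have: <<S>> \subset Group grS by rewrite gen_subG subsetUr.
  by case: genS => _ _ -> /subsetP; apply; rewrite inE.
move=> x y; rewrite cayleyE; apply/idP/idP => [|nxy].
  by apply: contraL => /eqP->; rewrite mulVg not1S.
by have /setU1P[/eqP|//] := allS (x^-1 * y); rewrite -eq_mulVg1 (negPf nxy).
Qed.

Lemma geod_nseq_le m n a : m <= n -> geod (nseq n a) -> geod (nseq m a).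
Proof. by move/subnKC <-; rewrite nseqD => /geod_cat[]. Qed.

Lemma geod_nseq_wlen n a : geod (nseq n a) -> wlen (a ^+ n) = n.
Proof. by move/geod_size; rewrite size_nseq ev_nseq. Qed.

Lemma geod_nseqS n a : 0 < n -> geod (nseq n a) -> a \in S.
Proof. by case: n => // n _ /geod_word/andP[]. Qed.

Lemma geod_nseqV n a : geod (nseq n a) -> geod (nseq n a^-1).
Proof.
move=> ga; have:= ga; rewrite /geodesic !size_nseq !ev_nseq expgVn wlenV.
case/andP=> Sw ->; rewrite andbT; apply/allP=> x /nseqP[-> n_gt0].
by rewrite /= (memSV genS) (geod_nseqS n_gt0).
Qed.

Lemma geod_nseq_inj n m a b : 0 < n -> geod (nseq n a) -> geod (nseq m b) ->
  a ^+ n = b ^+ m -> n = m /\ a = b.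
Proof.
move=> n0 ga gb e; have := geod_uniq geoS ga gb; rewrite !ev_nseq => /(_ e) E.
have nm : n = m by rewrite -(size_nseq n a) E size_nseq.
by split=> //; subst m; case: n n0 {ga gb e} E => // n _ [].
Qed.

Lemma central_power z : z \in Z -> z != 1 ->
  exists a n, [/\ a \in S, 0 < n, geod (nseq n a) & z = a ^+ n].
Proof.
move/centerTP=> cz nz; have [w gw ew] := geodP genS z.
case: w gw ew => [|a w] gw ew; first by rewrite ev_nil in ew; rewrite -ew eqxx in nz.
have Saw := geod_word gw; have /andP[Sa Sw] := Saw.
have er : ev (rcons w a) = z.
  rewrite ev_rcons; rewrite ev_cons in ew.
  by apply: (mulgI a); rewrite mulgA ew; exact: cz.
have gr : geod (rcons w a).
  rewrite /geodesic /word all_rcons [X in X && _]Saw er -ew size_rcons.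
  by rewrite -(geod_size gw) /=.
have Ew := cons_eq_rcons (geod_uniq geoS gw gr (etrans ew (esym er))).
exists a, (size w).+1; split=> //; first by rewrite /= -Ew.
by rewrite -ew ev_cons {1}Ew ev_nseq expgS.
Qed.

(** A central involution [z = a ^+ n] equals its inverse, so uniqueness gives [a = a^-1]; then
    [a * a = 1] forces [n = 1] and [z] is a generator. Away from [z], the words [a * b] and
    [(a * z) * (z * b)] collide. *)
Lemma even_center_closed : ~~ odd #|Z| -> closedS.
Proof.
move=> evZ; have [z Zz oz] : {z | z \in Z & #[z] = 2}.
  by apply: Cauchy; rewrite // dvdn2.
have nz : z != 1 by rewrite -order_gt1 oz.
have zV : z^-1 = z by apply/eqP; rewrite eq_invg_mul -(expg_order z) oz.
have [a [n [Sa n0 ga ez]]] := central_power Zz nz.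
have aV : a = a^-1.
  have [//|_ //] := geod_nseq_inj n0 ga (geod_nseqV ga).
  by rewrite expgVn -ez zV.
have n1 : n = 1%N.
  apply/eqP; rewrite eqn_leq n0 andbT leqNgt; apply/negP => n2.
  have := geod_nseq_wlen (geod_nseq_le n2 ga).
  by rewrite expgS expg1 {1}aV mulVg => /eqP; rewrite (eqP (_ : wlen 1 == 0)) ?wlen_eq0.
rewrite n1 expg1 in ez; rewrite {n n0 ga n1 aV}-ez in Sa => {a ez}.
move: Zz => /centerTP cz.
have SM a : a \in S -> a != z -> a * z \in S /\ z * a \in S.
  move=> aS naz; have E : z * a = a * z by exact: cz.
  have /setU1P[/eqP|] := commM aS Sa (commute_sym (cz a)) (elimN eqP naz).
    by rewrite -{1}zV -eq_mulgV1 (negPf naz).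
  by rewrite E.
have SZ a : a \in S -> a * z \in 1 |: S.
  move=> aS; have [->|naz] := eqVneq a z; first by rewrite -{1}zV mulVg setU11.
  by have [] := SM a aS naz => *; rewrite setU1r.
move=> a b aS bS; have [->|naz] := eqVneq a z; first by rewrite (cz b) SZ.
have [->|nbz] := eqVneq b z; first exact: SZ.
have [az _] := SM a aS naz; have [_ zb] := SM b bS nbz.
apply: (collide2 (c := a * z) (d := z * b)) => //.
  by rewrite mulgA -(mulgA a) -{1}zV mulVg mulg1.
by move/eqP; rewrite -{1}[a]mulg1 (inj_eq (mulgI a)) eq_sym (negPf nz).
Qed.

(** A generator other than [z] and [z^-1] puts [z * z] in [1 |: S] by [commute_sq]. Then [z] and
    [z^-1] multiply [S] into [1 |: S], and [a * b] collides with [(a * z) * (z^-1 * b)]. *)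
Lemma central_gen_closed z : z \in S -> z \in Z ->
  closedS \/ S \subset [set z; z^-1].
Proof.
move=> Sz /centerTP cz.
have [|/subsetPn[c Sc]] := boolP (S \subset [set z; z^-1]); first by right.
rewrite !inE negb_or => /andP[ncz nczV]; left.
have zz : z * z \in 1 |: S.
  apply: (commute_sq Sz Sc (cz c)); first by rewrite eq_sym.
  by rewrite eq_sym (inv_eq invgK).
have SVz : z^-1 \in S by rewrite (memSV genS).
have zM b : b \in S -> z * b \in 1 |: S.
  move=> Sb; have [<- //|nzb] := eqVneq z b.
  exact: (commM Sz Sb (cz b) (elimN eqP nzb)).
have zVM b : b \in S -> z^-1 * b \in 1 |: S.
  move=> Sb; have [<-|nzb] := eqVneq z^-1 b.
    by rewrite -invMg mem1SV.
  apply: (commM SVz Sb _ (elimN eqP nzb)).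
  exact: commute_sym (commuteV (commute_sym (cz b))).
move=> a b Sa Sb; have := zM a Sa; rewrite (cz a) => /setU1P[/eqP|Saz].
  by rewrite -{1}[z]invgK -eq_mulgV1 => /eqP->; exact: zVM.
have /setU1P[/eqP|Szb] := zVM b Sb.
  by rewrite -eq_mulVg1 => /eqP<-; rewrite setU1r.
apply: (collide2 (c := a * z) (d := z^-1 * b)) => //; first by rewrite mulgA mulgK.
by move/eqP; rewrite -{1}[a]mulg1 (inj_eq (mulgI a)) eq_sym (negPf (memS_neq1 genS Sz)).
Qed.

End GeodeticCayley.

(** * Abelian subgroups of index two *)

Lemma expg_gcd_eq1 (G : finGroupType) (x : G) m n :
  x ^+ m = 1 -> x ^+ n = 1 -> x ^+ gcdn m n = 1.
Proof.
move=> xm xn; apply/eqP; rewrite -order_dvdn dvdn_gcd.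
by rewrite !order_dvdn xm xn eqxx.
Qed.

Lemma odd_sqr_eq1 (G : finGroupType) (H : {group G}) (x : G) :
  odd #|H| -> x \in H -> x * x = 1 -> x = 1.
Proof.
move=> oH Hx xx; have := @expg_gcd_eq1 _ x 2 #|H| xx (expg_cardG Hx).
have /eqP-> : coprime 2 #|H| by rewrite coprime2n.
by rewrite expg1.
Qed.

Section IndexTwo.

Variables (G : finGroupType) (A : {group G}).
Implicit Types (x y t u : G).
Hypotheses (abA : abelian A) (indA : #|[set: G] : A| = 2).

Lemma card_index2 : #|[set: G]| = (#|A| * 2)%N.
Proof. by rewrite -(Lagrange (subsetT A)) indA. Qed.

Lemma index2_mem_mul x y : x \notin A -> y \notin A -> x * y \in A.
Proof.
move=> nAx nAy; have dAx : x \in [set: G] :\: A by rewrite !inE nAx.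
have: y^-1 \in [set: G] :\: A by rewrite !inE groupV nAy.
by rewrite -(rcoset_index2 (subsetT A) indA dAx) mem_rcoset -invMg groupV.
Qed.

Lemma abelian_mulC x y : x \in A -> y \in A -> x * y = y * x.
Proof. by move=> Ax Ay; apply: (centsP abA). Qed.

(** The elements [x * y] and [t * x^-1] of [A] commute. *)
Lemma index2_triple x y t : x \notin A -> y \notin A -> t \notin A ->
  x * y * t = t * y * x.
Proof.
move=> nAx nAy nAt; have := abelian_mulC (index2_mem_mul nAx nAy)
   (index2_mem_mul nAt (negbT (etrans (groupV _ _) (negPf nAx)))).
by move/(congr1 (fun z => z * x)); rewrite -!mulgA mulVg mulKg mulg1.
Qed.

(** Together [A] and [t] generate the group. *)
Lemma index2_center x t : x \in A -> t \notin A -> commute x t ->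
  x \in 'Z([set: G]).
Proof.
move=> Ax nAt cxt; apply/centerTP => g.
have [Ag|nAg] := boolP (g \in A); first exact: abelian_mulC.
have -> : g = g * t^-1 * t by rewrite mulgKV.
apply: commuteM => //; apply: abelian_mulC => //.
by rewrite index2_mem_mul // groupV.
Qed.

Lemma index2_sqr t : t \notin A -> t * t \in 'Z([set: G]).
Proof.
move=> nAt; apply: (@index2_center _ t) => //; first exact: index2_mem_mul.
exact: commute_sym (commuteM (commute_refl t) (commute_refl t)).
Qed.

Lemma index2_ex : exists t, t \notin A.
Proof.
have: ~~ ([set: G] \subset A) by rewrite -indexg_eq1 indA.
by case/subsetPn => t; exists t.
Qed.

Hypothesis oddZ : odd #|'Z([set: G])|.

(** For an involution [a] of [A] and [t] outside [A], the product [a * a ^ t] is central with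
    trivial square, hence trivial. So [t] fixes [a], which is then a central involution. *)
Lemma index2_odd : odd #|A|.
Proof.
apply/negPn/negP; rewrite -dvdn2 => evA.
have [a Aa oa] := Cauchy (isT : prime 2) evA; have [t nAt] := index2_ex.
have aa : a * a = 1 by rewrite -(expg_order a) oa.
have na : a != 1 by rewrite -order_gt1 oa.
have nA : t \in 'N(A).
  by apply: (subsetP (normal_norm (index2_normal (subsetT A) indA))); rewrite inE.
have Aat : a ^ t \in A by rewrite memJ_norm.
have att : (a ^ t) ^ t = a.
  by rewrite -conjgM; apply/conjg_fixP/commgP/commute_sym/(centerTP _ (index2_sqr nAt)).
have Zy : a * a ^ t \in 'Z([set: G]).
  apply: (index2_center (t := t)); first exact: groupM.
  - by [].
  by apply/commgP/conjg_fixP; rewrite conjMg att abelian_mulC.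
have y1 : a * a ^ t = 1.
  apply: (odd_sqr_eq1 oddZ Zy).
  by rewrite mulgA -(mulgA a) (abelian_mulC Aat Aa) (mulgA a a) aa mul1g -conjMg aa conj1g.
have at_a : a ^ t = a.
  by apply: (mulgI a); rewrite y1 aa.
have Za : a \in 'Z([set: G]).
  by apply: (index2_center Aa nAt); apply/commgP/conjg_fixP.
by rewrite (odd_sqr_eq1 oddZ Za aa) eqxx in na.
Qed.

End IndexTwo.

(** * Involutions and shortest words *)

Section Involutions.
Variables (G : finGroupType) (S : {set G}).
Implicit Types (g h z a b : G) (w u v : seq G).
Hypothesis genS : generating_set S.
Hypothesis geoS : geodetic (cayley S).

Notation wlen := (word_length genS).
Notation geod := (geodesic genS).
Notation Z := 'Z([set: G]).

Lemma geod_nseq_sqr n a : 2 <= n -> geod (nseq n a) -> a * a \notin 1 |: S.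
Proof.
move=> n2 /(geod_nseq_le n2)/geod_nseq_wlen; rewrite expgS expg1 => l2.
by rewrite -(wlen_le1 genS) l2.
Qed.

(** The reversed word of inverses is a shortest word of the same element, so the two words agree
    letter by letter. *)
Lemma sqr_eq1_ends s w x : geod (s :: rcons w x) ->
  ev (s :: rcons w x) * ev (s :: rcons w x) = 1 -> s = x^-1.
Proof.
set r := s :: rcons w x => gr; move/eqP; rewrite -eq_invg_mul => /eqP rV.
have gr' : geod (rev (map (fun y => y^-1) r)).
  rewrite /geodesic (word_rev_inv genS) ?geod_word // ev_rev_inv rV.
  by rewrite size_rev size_map (geod_size gr) /=.
have := geod_uniq geoS gr gr'; rewrite ev_rev_inv rV => /(_ erefl).
by rewrite /r -rcons_cons map_rcons rev_rcons /= => -[].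
Qed.

Lemma wlen_sqr_eq1 (r : G) : r * r = 1 -> wlen r <> 2.
Proof.
move=> rr; have [w gw ew] := geodP genS r; rewrite -ew -(geod_size gw).
case: w gw ew => [|s [|x [|//]]] gw ew //= _.
have := @sqr_eq1_ends s [::] x gw; rewrite ew => /(_ rr) sx.
have r1 : r = 1 by rewrite -ew !ev_cons ev_nil mulg1 sx mulVg.
by have := geod_size gw; rewrite ew r1 (eqP (_ : wlen 1 == 0)) ?wlen_eq0.
Qed.

(** By [sqr_eq1_ends] the shortest word of [r] has the form [s w s^-1], so [r] is conjugate to the
    element of [w], which is shorter; the process ends at a single letter. *)
Lemma generator_sqr_eq1 (r : G) : r != 1 -> r * r = 1 ->
  exists2 t, t \in S & t * t = 1.
Proof.
have [n] := ubnP (wlen r); elim: n r => // n IHn r lr r1 rr.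
have [w gw ew] := geodP genS r.
case: w gw ew => [|s w] gw ew; first by rewrite -ew ev_nil eqxx in r1.
case/lastP: w gw ew => [|w x] gw ew.
  exists r => //; have /andP[Ss _] := geod_word gw.
  by rewrite -ew ev_cons ev_nil mulg1.
have sx := sqr_eq1_ends gw; rewrite ew in sx; move/(_ rr) in sx.
have er : r = s * ev w * s^-1 by rewrite -ew ev_cons ev_rcons sx invgK mulgA.
apply: (IHn (ev w)).
- have := geod_word gw; rewrite /word /= all_rcons => /and3P[_ _ Sw].
  apply: leq_ltn_trans (wlen_le genS Sw) _; rewrite -ltnS.
  apply: leq_trans lr; rewrite -ew -(geod_size gw) /= size_rcons.
  by rewrite !ltnS leqnSn.
- by apply: contraNneq r1 => ew1; rewrite er ew1 mulg1 mulgV.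
apply: (mulgI s); apply: (mulIg s^-1).
by rewrite mulg1 mulgV -rr {1 2}er !mulgA mulgKV.
Qed.

Hypothesis oddZ : odd #|Z|.
Hypothesis ncS : forall a, a \in S -> a \notin Z.

Lemma center_notin1S z : z \in Z -> z != 1 -> z \notin 1 |: S.
Proof.
move=> Zz nz; rewrite !inE negb_or nz; apply/negP => Sz.
by move: (ncS Sz); rewrite Zz.
Qed.

Section IndexTwo.
Variable A : {group G}.
Hypotheses (abA : abelian A) (indA : #|[set: G] : A| = 2).

Let oddA := index2_odd abA indA oddZ.

Lemma sqr_eq1_notin (t : G) : t \in S -> t * t = 1 -> t \notin A.
Proof.
move=> St tt; apply: contra (memS_neq1 genS St) => At.
by apply/eqP; apply: odd_sqr_eq1 oddA At tt.
Qed.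

Lemma gen_involution : exists t, [/\ t \in S, t \notin A & t * t = 1].
Proof.
have [|r _ or] := @Cauchy _ 2 [set: G]%G isT.
  by rewrite (card_index2 indA) dvdn_mull.
have rr : r * r = 1 by rewrite -(expg_order r) or.
have r1 : r != 1 by rewrite -order_gt1 or.
have [t St tt] := generator_sqr_eq1 r1 rr.
by exists t; split=> //; exact: sqr_eq1_notin.
Qed.

(** Suppose [a * a != 1]; being central, it is not in [1 |: S]. With an involution [t] in [S], the
    conjugates [a * t * a^-1] and [a^-1 * t * a] coincide, so this involution [r] has length below
    3, hence is a generator. From [a * t = r * a] and [a * r = t * a] both products are generators,
    and [a * a = (a * r) * (a * t)] is a forbidden collision. *)
Lemma index2_gen_sqr a : a \in S -> a \notin A -> a * a = 1.
Proof.
move=> Sa nAa; apply/eqP/negPn/negP => naa.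
have Zaa := index2_sqr abA indA nAa.
have n1Saa := center_notin1S Zaa naa.
have [t [St nAt tt]] := gen_involution.
have SVa : a^-1 \in S by rewrite (memSV genS).
have nAVa : a^-1 \notin A by rewrite groupV.
have naV : a <> a^-1.
  by move=> aV; case/eqP: naa; rewrite {1}aV mulVg.
have nat : a <> t by move=> eat; case/eqP: naa; rewrite eat.
pose r := a * t * a^-1.
have er : r = a^-1 * t * a by exact: (index2_triple abA indA).
have rr : r * r = 1.
  by rewrite /r !mulgA mulgKV -(mulgA a) tt mulg1 mulgV.
have r1 : r != 1.
  apply/eqP=> r1; have: a * t = a by rewrite -[RHS]mul1g -r1 /r mulgKV.
  by rewrite -{2}[a]mulg1 => /mulgI t1; rewrite t1 in St; case/negP: (not1S genS).
have Sr : r \in S.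
  have l3 : wlen r < 3 by apply: (collide3 genS geoS Sa St SVa SVa St Sa er); constructor 1.
  have /setU1P[/eqP|//] : r \in 1 |: S; last by rewrite (negPf r1).
  rewrite -(wlen_le1 genS) -ltnS ltn_neqAle -ltnS l3 andbT.
  by apply/eqP; exact: wlen_sqr_eq1.
have Sat : a * t \in S.
  have /setU1P[at1|//] : a * t \in 1 |: S.
    apply: (collide2 genS geoS Sa St Sr Sa); first by rewrite /r mulgKV.
    by move=> ear; case/eqP: naa; rewrite ear.
  by case: nat; rewrite -[a]mulg1 -tt mulgA at1 mul1g.
have Sar : a * r \in S.
  have /setU1P[ar1|//] : a * r \in 1 |: S.
    apply: (collide2 genS geoS Sa Sr St Sa); first by rewrite er !mulgA mulgV mul1g.
    exact: nat.
  have ear : a = r by rewrite -[a]mulg1 -rr mulgA ar1 mul1g.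
  by case/eqP: naa; rewrite ear.
case/negP: n1Saa; apply: (collide2 genS geoS Sa Sa Sar Sat).
  rewrite er !mulgA mulgV mul1g -[t * a * a]mulgA -((centerTP _ Zaa) t).
  by rewrite -mulgA tt mulg1.
by move/eqP; rewrite -{1}[a]mulg1 (inj_eq (mulgI a)) eq_sym (negPf r1).
Qed.

End IndexTwo.
End Involutions.

Section IndexTwoCayley.
Variables (G : finGroupType) (S : {set G}).
Implicit Types (g h z a b : G) (w u v : seq G).
Hypothesis genS : generating_set S.
Hypothesis geoS : geodetic (cayley S).

Notation wlen := (word_length genS).
Notation geod := (geodesic genS).
Notation Z := 'Z([set: G]).
Hypothesis oddZ : odd #|Z|.
Hypothesis ncS : forall a, a \in S -> a \notin Z.

Section IndexTwo.
Variable A : {group G}.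
Hypotheses (abA : abelian A) (indA : #|[set: G] : A| = 2).

Let oddA := index2_odd abA indA oddZ.

(** The letter [s] of the shortest word of [y] has [s * s] outside [1 |: S]. It is thus not outside
    [A], where generators are involutions, and inside [A] it commutes with [b], so [commute_sq]
    leaves only [b] and [b^-1]. *)
Lemma index2_center_power b y : b \in S -> b \in A -> y \in Z -> y != 1 ->
  exists n, [/\ 1 < n, geod (nseq n b) & y = b ^+ n \/ y = b ^- n].
Proof.
move=> Sb Ab Zy ny; have [s [n [Ss n0 gs ey]]] := central_power genS geoS Zy ny.
have n2 : 1 < n.
  rewrite ltn_neqAle n0 andbT; apply/eqP => n1.
  by move: (ncS Ss); rewrite -n1 expg1 in ey; rewrite -ey Zy.
have nss := geod_nseq_sqr n2 gs.
have As : s \in A.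
  apply: contraR nss => nAs.
  by rewrite (index2_gen_sqr genS geoS oddZ ncS abA indA Ss nAs) setU11.
have [es|nsb] := eqVneq s b; first by exists n; rewrite -es; split=> //; left.
have [es|nsbV] := eqVneq s b^-1.
  exists n; split=> //; first by rewrite -[b]invgK -es geod_nseqV.
  by right; rewrite ey es expgVn.
by case/negP: nss; exact: (commute_sq genS geoS Ss Sb (abelian_mulC abA As Ab) nsb nsbV).
Qed.

Lemma expg2_eq1 k x : x \in A -> x ^+ (2 ^ k) = 1 -> x = 1.
Proof.
move=> Ax xk; have := expg_gcd_eq1 xk (expg_cardG Ax).
have /eqP-> : coprime (2 ^ k) #|A| by rewrite coprimeXl // coprime2n.
by rewrite expg1.
Qed.

(* [b * (t * b * t)] is central of length at most 4, so it is trivial or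
   [b ^+ 2], [b ^- 2], [b ^+ 3], [b ^- 3]; the exponents 2 and 3 are excluded. *)
Lemma index2_inverts b t : b \in S -> b \in A -> t \in S -> t \notin A ->
  t * b * t = b^-1.
Proof.
move=> Sb Ab St nAt; have tt := index2_gen_sqr genS geoS oddZ ncS abA indA St nAt.
have b1 := memS_neq1 genS Sb.
have nbt : b <> t by move=> e; rewrite -e Ab in nAt.
set c := t * b * t.
have tV : t^-1 = t by apply/eqP; rewrite eq_invg_mul tt.
have cX k : t * b ^+ k * t = c ^+ k.
  have conjt (x : G) : t * x * t = x ^ t by rewrite conjgE tV mulgA.
  by rewrite /c !conjt conjXg.
have cXV k : t * b ^- k * t = c ^- k.
  by rewrite -cX !invMg tV mulgA.
have tct : t * c * t = b by rewrite /c !mulgA tt mul1g -mulgA tt mulg1.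
have Ac : c \in A.
  by rewrite /c -mulgA; apply: (index2_mem_mul indA nAt); rewrite groupMl.
have lc : wlen c <= 3.
  apply: (@wlen_le_eq _ _ genS _ [:: t; b; t]); rewrite /word /= ?St ?Sb //.
  by rewrite !ev_cons ev_nil mulg1 mulgA.
have Zy : b * c \in Z.
  apply: (index2_center abA indA (groupM Ab Ac) nAt).
  by rewrite /commute {1}(abelian_mulC abA Ab Ac) /c !mulgA.
have [y1|ny] := eqVneq (b * c) 1; first by apply/eqP; rewrite eq_sym eq_invg_mul y1.
have [n [n2 gb ey]] := index2_center_power Sb Ab Zy ny.
have nbb := geod_nseq_sqr n2 gb.
(* If [n = 4], then [b t b t] is itself the shortest word, hence a power of [b] or [b^-1], and [t]
   would be one of these. *)
have n3 : n <= 3.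
  pose w := [:: b; t; b; t].
  have Sw : word S w by rewrite /word /= Sb St.
  have ew : ev w = b * c by rewrite !ev_cons ev_nil mulg1 /c !mulgA.
  have ly : wlen (b * c) = n.
    by case: ey => ->; rewrite -?expgVn geod_nseq_wlen // geod_nseqV.
  have := wlen_le genS Sw; rewrite ew ly /= leq_eqVlt => /orP[/eqP n4|//].
  have gw : geod w by rewrite /geodesic Sw ew ly n4.
  have wt x : geod (nseq n x) -> b * c = x ^+ n -> t = x.
    move=> gx; rewrite -ew -ev_nseq => /(geod_uniq geoS gw gx).
    by rewrite n4 => -[].
  have nbV : t != b^-1 by apply: contraNneq nAt => ->; rewrite groupV.
  case: ey => [/(wt _ gb)/esym//|]; rewrite -expgVn => /(wt _ (geod_nseqV gb)).
  by move/eqP: nbV.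
have [k2 k3] : (b ^+ 2 = 1 -> b = 1) /\ (b ^+ 3 = 1 -> n = 3 -> b * c = 1).
  split; first by move=> b2; apply: (odd_sqr_eq1 oddA Ab).
  by move=> b3 e3; case: ey => ->; rewrite e3 b3 ?invg1.
have cE x : b * c = b * x -> c = x by apply: mulgI.
(* For [b ^+ 2], [t] commutes with [b]. For [b ^- 2], [c = b ^- 3], and conjugating twice gives
   [b = b ^+ 9], impossible in odd order. *)
have [e2|n_neq2] := eqVneq n 2.
  case: ey; rewrite {}e2 => ey.
    have cb : c = b by apply: cE; rewrite ey.
    case/negP: nbb; apply: (commute_sq genS geoS Sb St).
    - by rewrite /commute -{1}cb /c -mulgA tt mulg1.
    - exact/eqP.
    - by rewrite tV; apply/eqP.
  have cb : c = b ^- 3.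
    by apply: cE; rewrite ey (expgSr b 2) (invMg (b ^+ 2)) mulKVg.
  have b9 : b = b ^+ 9 by rewrite -{1}tct cb cXV cb -expgVn invgK -expgM.
  case/eqP: b1; apply: (@expg2_eq1 3) => //.
  by apply: (mulgI b); rewrite -expgS mulg1.
have e3 : n = 3 by apply/eqP; rewrite eqn_leq n3 ltn_neqAle eq_sym n_neq2.
case: (ey); rewrite {1}e3 => ey3.
  have cb : c = b ^+ 2 by apply: cE; rewrite ey3.
  have b4 : b = b ^+ 4 by rewrite -{1}tct cb cX cb -expgM.
  have b3 : b ^+ 3 = 1 by apply: (mulgI b); rewrite -expgS mulg1.
  by rewrite k3 ?eqxx in ny.
have cb : c = b ^- 4.
  by apply: cE; rewrite ey3 (expgSr b 3) (invMg (b ^+ 3)) mulKVg.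
have b15 : b ^+ 15 = 1.
  by apply: (mulgI b); rewrite -expgS mulg1 -{2}tct cb cXV cb -expgVn invgK -expgM.
(* The remaining case has [c = b ^- 4] and [b ^+ 15 = 1]. The central element [b ^+ 6] is
   nontrivial, so it is [b ^+ m] or [b ^- m], where [m <= 3] because [c] has length at most 3. Each
   choice makes [b] or [b ^+ 3] trivial. *)
have Zb6 : b ^+ 6 \in Z.
  have : b ^+ 3 \in Z by rewrite -groupV -ey3.
  by move=> Zb3; rewrite (expgM b 3 2) groupX.
have nb3 : b ^+ 3 <> 1 by move/k3/(_ e3)/eqP; rewrite (negPf ny).
have nb6 : b ^+ 6 != 1.
  by apply/eqP=> b6; apply: nb3; apply: (expg_gcd_eq1 b6 b15).
have [m [m2 gm em]] := index2_center_power Sb Ab Zb6 nb6.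
have m3 : m <= 3.
  rewrite leqNgt; apply/negP => m4.
  have := geod_nseq_wlen (geod_nseq_le m4 gm).
  by move=> l4; move: lc; rewrite cb wlenV l4.
have bpow k : b ^+ (2 ^ k) <> 1 by move/(expg2_eq1 Ab)/eqP; apply/negP.
have [e2|m_neq2] := eqVneq m 2.
  case: em => em; [case: (bpow 2) | case: (bpow 3)].
    by apply: (mulgI (b ^+ 2)); rewrite -expgD mulg1 em e2.
  by rewrite (expgD b 6 2) em e2 mulVg.
have m_eq3 : m = 3 by apply/eqP; rewrite eqn_leq m3 ltn_neqAle eq_sym m_neq2.
apply: False_ind; apply: nb3; case: em; rewrite m_eq3 => em.
  by apply: (mulgI (b ^+ 3)); rewrite -expgD mulg1 em.
have b9 : b ^+ 9 = 1 by rewrite (expgD b 6 3) em mulVg.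
exact: (expg_gcd_eq1 b9 b15).
Qed.

Lemma ev_index2 w : S \subset ~: A -> word S w ->
  (ev w \in A) = ~~ odd (size w).
Proof.
move=> SA; elim: w => [|x w IHw]; first by rewrite ev_nil group1.
case/andP=> Sx /IHw {}IHw; rewrite ev_cons /=.
have nAx : x \notin A by move/subsetP/(_ _ Sx): SA; rewrite inE.
have [Aw|nAw] := boolP (ev w \in A); rewrite -?IHw.
  by rewrite Aw groupMr // (negPf nAx).
by rewrite (negPf nAw) (index2_mem_mul indA).
Qed.

(* The Cayley graph is bipartite, so all neighbours of a vertex farthest from 1
   are closer to 1, and only one of them can be on a shortest path. *)
Lemma index2_bipartite s t : S \subset ~: A -> s \in S -> t \in S -> s = t.
Proof.
move=> SA Ss St.
have [x _ xmax] := @arg_maxnP G 1 predT wlen isT.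
have last_x y : y \in S -> exists w, geod (rcons w y^-1) /\ ev (rcons w y^-1) = x.
  move=> Sy; have [w gw ew] := geodP genS (x * y).
  have ex : ev (rcons w y^-1) = x by rewrite ev_rcons ew mulgK.
  exists w; split=> //; rewrite /geodesic ex size_rcons.
  have Sw : all [in S] w := geod_word gw.
  rewrite /word all_rcons Sw /= (memSV genS) Sy /=.
  have [v gv ev_] := geodP genS x.
  have: size w <= wlen x by rewrite (geod_size gw) ew; exact: xmax.
  rewrite leq_eqVlt => /orP[|//].
  rewrite -{1}ev_ -(geod_size gv) => /eqP e.
  have nAy : y \notin A by move/subsetP/(_ _ Sy): SA; rewrite inE.
  have := ev_index2 SA (geod_word gw); have := ev_index2 SA (geod_word gv).
  rewrite e ew ev_ => <-; case: (boolP (x \in A)) => [Ax|nAx].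
    by rewrite groupMl // (negPf nAy).
  by rewrite (index2_mem_mul indA).
have [u [gu eu]] := last_x s Ss; have [v [gv ev_]] := last_x t St.
have := geod_uniq geoS gu gv; rewrite eu ev_ => /(_ erefl)/rcons_inj[_].
exact: invg_inj.
Qed.

(** If no generator is in [A], the bipartite case leaves only the involution [t0]. Otherwise
    [t * b = b^-1 * t] makes mixed products generators. Two generators in [A] are handled by
    inserting [t0 * t0], two outside by inserting [b0 * b0^-1]. *)
Lemma index2_closed : closedS S.
Proof.
have [t0 [St0 nAt0 t00]] := gen_involution genS geoS oddZ abA indA.
have [SA|/subsetPn[b0 Sb0]] := boolP (S \subset ~: A).
  move=> a b Sa Sb.
  by rewrite (index2_bipartite SA Sa St0) (index2_bipartite SA Sb St0) t00 setU11.
rewrite inE negbK => Ab0.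
have sq t : t \in S -> t \notin A -> t * t = 1.
  by move=> St nAt; apply: index2_gen_sqr genS geoS oddZ ncS _ abA indA _ St nAt.
have tb b t : b \in S -> b \in A -> t \in S -> t \notin A -> t * b = b^-1 * t.
  move=> Sb Ab St nAt; rewrite -(index2_inverts Sb Ab St nAt).
  by rewrite -mulgA sq ?mulg1.
have bt b t : b \in S -> b \in A -> t \in S -> t \notin A -> b * t \in S.
  move=> Sb Ab St nAt; have SVb : b^-1 \in S by rewrite (memSV genS).
  have /setU1P[bt1|//] : b * t \in 1 |: S.
    apply: (collide2 genS geoS Sb St St SVb).
      by rewrite tb ?groupV // invgK.
    by move=> e; rewrite -e Ab in nAt.
  by case/negP: nAt; rewrite -(groupMl _ Ab) bt1 group1.
have tbS b t : b \in S -> b \in A -> t \in S -> t \notin A -> t * b \in S.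
  by move=> Sb Ab St nAt; rewrite tb // bt ?groupV // (memSV genS).
move=> x y Sx Sy; case: (boolP (x \in A)) (boolP (y \in A)) => [Ax|nAx] [Ay|nAy].
- apply: (collide2 genS geoS Sx Sy (bt x t0 _ _ _ _) (tbS y t0 _ _ _ _)) => //.
    by rewrite mulgA -(mulgA x) t00 mulg1.
  by rewrite -{1}[x]mulg1 => /mulgI e; rewrite -e group1 in nAt0.
- by rewrite setU1r ?bt.
- by rewrite setU1r ?tbS.
apply: (collide2 genS geoS Sx Sy (tbS b0 x _ _ _ _) (bt b0^-1 y _ _ _ _));
  rewrite ?groupV ?(memSV genS) //; first by rewrite mulgA mulgK.
rewrite -{1}[x]mulg1 => /mulgI e; move: (memS_neq1 genS Sb0).
by rewrite -e eqxx.
Qed.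

End IndexTwo.
End IndexTwoCayley.

(** * Lengths of central elements *)

Section CentralPowers.
Variables (G : finGroupType) (S : {set G}).
Implicit Types (g h z a b : G) (w u v : seq G).
Hypothesis genS : generating_set S.
Hypothesis geoS : geodetic (cayley S).

Notation wlen := (word_length genS).
Notation geod := (geodesic genS).
Notation Z := 'Z([set: G]).
Hypothesis oddZ : odd #|Z|.
Hypothesis ncS : forall a, a \in S -> a \notin Z.

Lemma geod_nseq_eq1 n a : 0 < n -> geod (nseq n a) -> a ^+ n != 1.
Proof. by move=> n0 gn; rewrite -(wlen_eq0 genS) geod_nseq_wlen // -lt0n. Qed.

(** Both [b :: w] and [rcons w b] are shortest words of the same element. *)
Lemma geod_commute w b : geod w -> b \in S -> commute (ev w) b ->
  wlen (ev w * b) = (size w).+1 -> w = nseq (size w) b.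
Proof.
move=> gw Sb cwb lwb; apply: cons_eq_rcons; have Sw : all [in S] w := geod_word gw.
apply: (geod_uniq geoS (genS := genS)).
- by rewrite /geodesic /word /= Sb Sw ev_cons -cwb lwb /=.
- by rewrite /geodesic /word all_rcons Sw /= Sb ev_rcons lwb size_rcons /=.
by rewrite ev_cons ev_rcons.
Qed.

(* At the first [j] where the length exceeds [n], the shortest word of
   [a ^+ n * b ^+ j] commutes with [b], hence is a power of [b]. *)
Lemma wlen_central_mul n m a b j : 0 < n -> n <= m ->
  geod (nseq n a) -> a ^+ n \in Z -> geod (nseq m b) -> b <> a -> b <> a^-1 ->
  j <= m -> wlen (a ^+ n * b ^+ j) <= n.
Proof.
move=> n0 nm ga /centerTP Za gb nba nbaV.
have Sb : b \in S by apply: geod_nseqS gb; exact: leq_trans nm.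
elim: j => [_|j IHj jm]; first by rewrite mulg1 geod_nseq_wlen.
have {}IHj := IHj (ltnW jm); rewrite leqNgt; apply/negP => lt_n.
have [w gw ew] := geodP genS (a ^+ n * b ^+ j).
have l1 := wlenM genS (a ^+ n * b ^+ j) b; rewrite (wlenS genS Sb) addn1 in l1.
rewrite -mulgA -expgSr in l1.
have ln : wlen (a ^+ n * b ^+ j) = n.
  by apply/eqP; rewrite eqn_leq IHj -ltnS (leq_trans lt_n l1).
have ln1 : wlen (a ^+ n * b ^+ j.+1) = n.+1.
  by apply/eqP; rewrite eqn_leq lt_n -{2}ln l1.
have sw : size w = n by rewrite (geod_size gw) ew.
have cw : commute (ev w) b.
  rewrite ew; apply/commute_sym/commuteM; first exact/commute_sym/Za.
  exact/commuteX/commute_refl.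
have := geod_commute gw Sb cw; rewrite ew -mulgA -expgSr ln1 sw => /(_ erefl) eww.
have e : a ^+ n * b ^+ j = b ^+ n by rewrite -ew eww ev_nseq.
(* Cancelling powers of [b] equates [a ^+ n] or [a^-1 ^+ n] with a geodesic power of [b], against
   uniqueness. *)
have [le_jn|lt_nj] := leqP j n.
  have e2 : a ^+ n = b ^+ (n - j).
    by apply: (mulIg (b ^+ j)); rewrite e -expgD subnK.
  have gnj := geod_nseq_le (leq_trans (leq_subr j n) nm) gb.
  by have [_ /esym] := geod_nseq_inj geoS n0 ga gnj e2.
have e2 : a^-1 ^+ n = b ^+ (j - n).
  apply: (mulIg (b ^+ n)); rewrite -expgD subnK ?(ltnW lt_nj) // -e.
  by rewrite expgVn mulKg.
have gjn := geod_nseq_le (leq_trans (leq_subr n j) (ltnW jm)) gb.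
by have [_ /esym] := geod_nseq_inj geoS n0 (geod_nseqV ga) gjn e2.
Qed.

(** Take [a ^+ d] central, nontrivial and of minimal length. Division with remainder settles powers
    of [a]; any other [b ^+ m] is shown to have length exactly [d]. *)
Lemma center_wlen_dvd : Z != 1 ->
  exists a d, [/\ 1 < d, geod (nseq d a), a ^+ d \in Z,
    forall k, a ^+ k \in Z -> d %| k &
    forall b m, geod (nseq m b) -> b ^+ m \in Z -> d %| m].
Proof.
case/trivgPn=> z0 Zz0 nz0.
have P0 : (z0 \in Z) && (z0 != 1) by rewrite Zz0.
have [z1 /andP[Zz1 nz1] zmin] :=
  @arg_minnP G z0 (fun z => (z \in Z) && (z != 1)) wlen P0.
have {}zmin z : z \in Z -> z != 1 -> wlen z1 <= wlen z.
  by move=> Zz nz; apply: zmin; rewrite Zz.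
have [a [d [Sa d0 ga ez1]]] := central_power genS geoS Zz1 nz1.
have lz1 : wlen z1 = d by rewrite ez1 geod_nseq_wlen.
rewrite {z0 Zz0 nz0 P0}lz1 in zmin.
have Zad : a ^+ d \in Z by rewrite -ez1.
have d1 : 1 < d.
  rewrite ltn_neqAle d0 andbT; apply/eqP => d1.
  by have := ncS Sa; rewrite -d1 expg1 in Zad; rewrite Zad.
have dvda k : a ^+ k \in Z -> d %| k.
  rewrite {1}(divn_eq k d) expgD mulnC expgM (groupMl _ (groupX _ Zad)) => Zr.
  rewrite /dvdn; apply: contraTT (ltn_pmod k d0); rewrite -lt0n -leqNgt => r0.
  have gr := geod_nseq_le (ltnW (ltn_pmod k d0)) ga.
  by have := zmin _ Zr (geod_nseq_eq1 r0 gr); rewrite geod_nseq_wlen.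
exists a, d; split=> // b m gb Zbm.
case: (posnP m) => [->|m0]; first exact: dvdn0.
have [eb|nba] := eqVneq b a; first by apply: dvda; rewrite -eb.
have [eb|nbaV] := eqVneq b a^-1.
  by apply: dvda; rewrite -groupV -expgVn -eb.
have nz2 := geod_nseq_eq1 m0 gb; have lz2 := geod_nseq_wlen gb.
have dm : d <= m by rewrite -lz2 zmin.
suff md : m <= d by rewrite (eqP (_ : m == d)) // eqn_leq md.
have gaV := geod_nseqV ga.
have ZaVd : a^-1 ^+ d \in Z by rewrite expgVn groupV.
have key (x c : G) k : k = d -> geod (nseq d c) -> c ^+ d \in Z -> geod (nseq k x) ->
    x <> c -> x <> c^-1 -> wlen (c ^+ d * x ^+ k) <= d.
  move=> -> gc Zc gx xc xcV.
  exact: wlen_central_mul d0 (leqnn d) gc Zc gx xc xcV (leqnn d).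
(* The product [u] is central of length at most [d], so [u = e ^+ d]. Unless [e = c^-1], the product
   [c^-1 ^+ d * e ^+ d], which equals [b ^+ m], again has length at most [d]. *)
have step c : geod (nseq d c) -> c ^+ d \in Z -> b <> c -> b <> c^-1 ->
    m <= d \/ b ^+ m = (c ^+ d)^-1 * (c ^+ d)^-1.
  move=> gc Zc nbc nbcV; have lu := wlen_central_mul d0 dm gc Zc gb nbc nbcV (leqnn m).
  set u := _ * _ in lu; have Zu : u \in Z by rewrite groupM.
  have eb : b ^+ m = c^-1 ^+ d * u by rewrite expgVn mulKg.
  have gcV := geod_nseqV gc; have ZcV : c^-1 ^+ d \in Z by rewrite expgVn groupV.
  have nu : u != 1.
    apply/eqP=> u1; rewrite u1 mulg1 in eb.
    by have [_] := geod_nseq_inj geoS m0 gb gcV eb.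
  have [e [k [Se k0 ge eu]]] := central_power genS geoS Zu nu.
  have kd : k = d.
    apply/eqP; rewrite eqn_leq -(geod_nseq_wlen ge) -eu lu /=.
    exact: zmin.
  have [ec|/eqP nec] := eqVneq e c.
    by case/eqP: nz2; rewrite eb eu kd ec expgVn mulVg.
  have [ec|/eqP necV] := eqVneq e c^-1.
    by right; rewrite eb eu kd ec expgVn.
  left; rewrite -lz2 eb eu; apply: key => //.
  by rewrite invgK.
have [//|e1] := step a ga Zad (elimN eqP nba) (elimN eqP nbaV).
have [||//|e2] := step a^-1 gaV ZaVd; [exact/eqP|by rewrite invgK; exact/eqP|].
rewrite expgVn invgK -ez1 in e2; rewrite -ez1 in e1.
(* Both exceptional cases together say that [b ^+ m] is [z1 ^- 2] and [z1 ^+ 2], against the odd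
   order of the centre. *)
have z4 : z1 ^+ 4 = 1.
  by rewrite (expgD z1 2 2) {1}[z1 ^+ 2]expgS expg1 -e2 e1 expgS expg1 -invMg mulVg.
have := expg_gcd_eq1 z4 (expg_cardG Zz1).
have /eqP-> : coprime (2 ^ 2) #|Z| by rewrite coprimeXl // coprime2n.
by move/eqP; rewrite expg1 (negPf nz1).
Qed.

Lemma wlen_commg g h : wlen [~ g, h] <= (wlen g + wlen h).*2.
Proof.
rewrite commgEl conjgE; apply: leq_trans (wlenM genS _ _) _.
rewrite wlenV -addnn -addnA leq_add2l.
apply: leq_trans (wlenM genS _ _) _.
rewrite wlenV leq_add2l; exact: wlenM.
Qed.

(** * Nilpotent groups *)

Hypothesis nilG : nilpotent [set: G].
Let s := nil_class [set: G].

(** Modulo [K], the centraliser of [g] contains the generators. *)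
Lemma commg_gen_sub (K : {group G}) g : K <| [set: G] ->
  (forall x, x \in S -> [~ g, x] \in K) -> [~: [set g], [set: G]] \subset K.
Proof.
case/andP=> _ nK gSK.
have nKA (A : {set G}) : A \subset 'N(K) by exact: subset_trans (subsetT A) nK.
case: genS => _ _ <-; rewrite -quotient_cents2 // quotient_gen // cent_gen.
rewrite quotient_cents2 // gen_subG; apply/subsetP=> _ /imset2P[_ x /set1P-> Sx ->].
exact: gSK.
Qed.

(** Start from a generator outside the last proper term of the upper central series and descend by
    commutators with generators. Each step turns a length bound [l] into [2 * (l + 1)], and [l = 1]
    at the start yields [3 * 2 ^ i - 2]. *)
Lemma ucn_short_element i : i < s ->
  exists g, [/\ g \in 'Z_(s - i)([set: G]), g \notin 'Z_(s - i).-1([set: G]) &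
    wlen g <= 3 * 2 ^ i - 2].
Proof.
elim: i => [|i IHi] lt_is.
  rewrite subn0; have Zs : 'Z_s([set: G]) = [set: G] by apply/ucn_nil_classP.
  have nZ : ~~ ([set: G] \subset 'Z_s.-1([set: G])).
    apply/negP => sub; have: s <= s.-1.
      by apply/ucn_nil_classP=> //; apply/eqP; rewrite eqEsubset subsetT.
    by rewrite leqNgt prednK // leqnn.
  have: ~~ (S \subset 'Z_s.-1([set: G])).
    by apply: contra nZ; case: genS => _ _ <-; rewrite gen_subG.
  case/subsetPn=> x Sx nZx; exists x; rewrite Zs inE; split=> //.
  by rewrite (wlenS genS Sx).
have [g [Zg nZg lg]] := IHi (ltnW lt_is).
have [k ek] : exists k, s - i = k.+2.
  by exists (s - i.+2); lia.
rewrite ek /= in Zg nZg; rewrite subnS ek /=.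
have [x Sx nZx] : exists2 x, x \in S & [~ g, x] \notin 'Z_k([set: G]).
  apply/exists_inP; apply: contraR nZg; rewrite negb_exists_in => /forall_inP all.
  rewrite ucnSnR inE in_setT; apply: commg_gen_sub; first exact: ucn_normal.
  by move=> x /all; rewrite negbK.
exists [~ g, x]; split=> //.
  apply: (subsetP (ucn_comm k.+1 [set: G]%G)).
  by apply: mem_commg; [exact: Zg | exact: in_setT].
have := wlen_commg g x; rewrite (wlenS genS Sx) expnS.
have : 0 < 2 ^ i by rewrite expn_gt0.
lia.
Qed.

Lemma nilpotent_false : ~~ cyclic [set: G] ->
  (forall p : nat, prime p -> odd p -> p < 3 * 2 ^ (s - 1) - 2 ->
     ~~ (p %| exponent [set: G] %/ exponent Z)) -> False.
Proof.
move=> ncyc hp.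
have s0 : 0 < s.
  rewrite lt0n nil_class0; apply: contra ncyc => /eqP->; exact: cyclic1.
have [g [Zg nZg lg]] := @ucn_short_element s.-1 (eq_leq (prednK s0)).
have es : s - s.-1 = 1%N by lia.
rewrite es ucn1 in Zg; rewrite es /= ucn0 inE in nZg; rewrite -subn1 in lg.
have ntZ : Z != 1 by apply/trivgPn; exists g.
have [a [d [d1 ga Zad dvda dvd_d]]] := center_wlen_dvd ntZ.
have dB : d <= 3 * 2 ^ (s - 1) - 2.
  have [b [m [Sb m0 gb eg]]] := central_power genS geoS Zg nZg.
  apply: leq_trans lg; rewrite eg geod_nseq_wlen //.
  by apply: dvdn_leq => //; apply: dvd_d gb _; rewrite -eg.
set p := pdiv d; have prp : prime p := pdiv_prime d1.
have pd : p %| d := pdiv_dvd d.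
have oddG : odd #|[set: G]|.
  apply: contraLR oddZ => evG.
  have: 2 \in \pi([set: G]) by rewrite mem_primes cardG_gt0 dvdn2.
  by rewrite -pi_center_nilpotent // mem_primes => /and3P[_ _]; rewrite dvdn2.
have pa : p %| #[a].
  by apply: dvdn_trans pd _; apply: dvda; rewrite expg_order group1.
have aE : #[a] %| exponent [set: G] by rewrite dvdn_exponent ?inE.
have op : odd p by apply: dvdn_odd pa (dvdn_odd (order_dvdG (in_setT a)) oddG).
(* Equality is impossible: the bound is 1 when [s = 1], and even otherwise, while [p] is odd. *)
have p_lt : p < 3 * 2 ^ (s - 1) - 2.
  rewrite ltn_neqAle (leq_trans (dvdn_leq (ltnW d1) pd) dB) andbT.
  apply/eqP => ep; case es1 : (s - 1)%N => [|k] in ep dB.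
    by have := leq_trans d1 dB.
  by move: op; rewrite ep expnS mulnCA -[X in _ - X]muln1 -mulnBr oddM.
have ZG : exponent Z %| exponent [set: G] := exponentS (subsetT Z).
have E0 : 0 < exponent [set: G] by exact: exponent_gt0.
(* The hypothesis on [p] says that the centre attains the full [p]-part of the exponent. *)
have eqlog : logn p (exponent Z) = logn p (exponent [set: G]).
  apply/eqP; rewrite eqn_leq dvdn_leq_log // leqNgt; apply/negP => lt_log.
  case/negP: (hp p prp op p_lt).
  have : 0 < logn p (exponent [set: G] %/ exponent Z).
    by rewrite logn_div // subn_gt0.
  by rewrite logn_gt0 mem_primes => /and3P[].
have [z Zz ez] := exponent_witness (abelian_nil (center_abelian [set: G]%G)).
have pz : p %| #[z].
  have : 0 < logn p (exponent Z).
    by rewrite eqlog logn_gt0 mem_primes prp E0 (dvdn_trans pa).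
  by rewrite ez logn_gt0 mem_primes => /and3P[].
have nz : z != 1.
  by apply: contraTneq pz => ->; rewrite order1 gtnNdvd // prime_gt1.
have [b [m [Sb m0 gb ezb]]] := central_power genS geoS Zz nz.
have pm : p %| m.
  by apply: dvdn_trans pd _; apply: dvd_d gb _; rewrite -ezb.
have oz : #[z] = #[b] %/ gcdn #[b] m by rewrite ezb orderXgcd.
have pb : p %| #[b] by rewrite (dvdn_trans pz) // oz dvdn_div ?dvdn_gcdl.
have bE : #[b] %| exponent [set: G] by rewrite dvdn_exponent ?inE.
(* As [p] divides both [m] and the order of [b], the order of [z = b ^+ m] has a strictly smaller
   [p]-part than that of [b], although it is already maximal. *)
have := dvdn_leq_log p E0 bE; rewrite -eqlog ez oz logn_div ?dvdn_gcdl //.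
rewrite leqNgt ltn_subrL !logn_gt0 !mem_primes prp gcdn_gt0 order_gt0.
by rewrite dvdn_gcd pb pm.
Qed.
End CentralPowers.

(** * Central derived subgroups of prime order *)

(** Trades conjugation by [c^-1] for conjugation by [c] at the cost of inverting [v], which fixes
    the sign of a commutator. *)
Lemma conj_inv_swap (G : groupType) (c v z : G) : commute z (v * c) ->
  c * v * c^-1 = z * v -> c^-1 * v^-1 * c = z * v^-1.
Proof.
move=> cz e; apply: (mulgI c); rewrite !mulgA mulgV mul1g; apply: (mulIg v).
rewrite mulgKV; apply: (mulgI v); rewrite !mulgA mulgV mul1g.
by rewrite -[c * v](mulgKV c) e -(mulgA z) cz.
Qed.

Section CentralDerived.
Variables (G : finGroupType) (S : {set G}).
Implicit Types (g h z a b c u v : G) (w : seq G).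
Hypothesis genS : generating_set S.
Hypothesis geoS : geodetic (cayley S).

Notation wlen := (word_length genS).
Notation geod := (geodesic genS).
Notation Z := 'Z([set: G]).

(** Length [n.+1] would make the word of [c ^+ n] a power of [u], by [geod_commute]. Length below
    [n] would give a shortest word of [c ^+ n] ending in [u^-1]. *)
Lemma wlen_central_gen n c u : geod (nseq n c) -> c ^+ n \in Z -> u \in S ->
  0 < n -> u <> c -> u <> c^-1 -> wlen (c ^+ n * u) = n.
Proof.
move=> gc /centerTP Zc Su n0 nuc nucV; apply/eqP; rewrite eqn_leq; apply/andP; split.
  rewrite leqNgt; apply/negP => lt_n.
  have le := wlenM genS (c ^+ n) u; rewrite (wlenS genS Su) addn1 in le.
  rewrite geod_nseq_wlen // in le.
  have := geod_commute geoS gc Su; rewrite ev_nseq size_nseq => /(_ (Zc u)).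
  have -> : wlen (c ^+ n * u) = n.+1 by apply/eqP; rewrite eqn_leq le.
  by case: (n) n0 => // m _ /(_ erefl)[/esym].
rewrite leqNgt; apply/negP => lt_n; have [w gw ew] := geodP genS (c ^+ n * u).
have ec : ev (rcons w u^-1) = c ^+ n by rewrite ev_rcons ew mulgK.
have Sw : all [in S] w := geod_word gw.
have gr : geod (rcons w u^-1).
  rewrite /geodesic /word all_rcons Sw /= (memSV genS) Su ec geod_nseq_wlen //.
  by rewrite size_rcons (geod_size gw) ew.
have := geod_uniq geoS gr gc; rewrite ec ev_nseq => /(_ erefl).
case: (n) n0 => // m _; rewrite -addn1 nseqD cats1 => /rcons_inj[_ e].
by case: nucV; rewrite -e invgK.
Qed.

Lemma geod_gen_commute n c v : 1 < n -> geod (nseq n c) -> v \in S ->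
  commute c v -> v = c \/ v = c^-1.
Proof.
move=> n1 gc Sv ccv; have [->|ncv] := eqVneq c v; first by left.
have [->|ncvV] := eqVneq c v^-1; first by right; rewrite invgK.
case/negP: (geod_nseq_sqr n1 gc).
exact: (commute_sq genS geoS (geod_nseqS (ltnW n1) gc) Sv ccv ncv ncvV).
Qed.

Lemma noncentral_gen g : g \notin Z -> exists2 v, v \in S & g * v != v * g.
Proof.
move=> nZg; apply/exists_inP; apply: contraR nZg.
rewrite negb_exists_in => /forall_inP cg; rewrite inE in_setT.
case: genS => _ _ <-; rewrite cent_gen; apply/centP=> v /cg.
by rewrite negbK => /eqP.
Qed.

Section DerivedOrder3.

Variable c : G.
Notation D := ([set: G]^`(1)).
Hypotheses (cardD : #|D| = 3) (DZ : D \subset Z).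
Hypothesis dvd3 : forall b m, geod (nseq m b) -> b ^+ m \in Z -> 3 %| m.
Hypotheses (gc : geod (nseq 3 c)) (Dc3 : c ^+ 3 \in D).

Let Sc : c \in S := geod_nseqS (isT : 0 < 3) gc.
Let SVc : c^-1 \in S. Proof. by rewrite (memSV genS). Qed.
Let Zc3 : c ^+ 3 \in Z := subsetP DZ _ Dc3.
Let c9 : c ^+ 9 = 1.
Proof. by have := expg_cardG Dc3; rewrite cardD => <-; rewrite -expgM. Qed.

Lemma der3_neqV : c ^+ 3 != c ^- 3.
Proof.
apply/eqP=> e; have c6 : c ^+ 6 = 1 by rewrite (expgD c 3 3) {1}e mulVg.
by case/eqP: (geod_nseq_eq1 (isT : 0 < 3) gc); exact: (expg_gcd_eq1 c6 c9).
Qed.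

Lemma der3_cases k : k \in D -> [\/ k = 1, k = c ^+ 3 | k = c ^- 3].
Proof.
move=> Dk; have n1 := geod_nseq_eq1 (isT : 0 < 3) gc.
have: k \in [set 1; c ^+ 3; c ^- 3].
  suff -> : [set 1; c ^+ 3; c ^- 3] = D by [].
  apply/eqP; rewrite eqEcard cardD -setUA cardsU1 cards2 der3_neqV !inE.
  rewrite eq_sym (negPf n1) eq_sym eq_invg1 (negPf n1) andbT.
  by apply/subsetP=> x; rewrite !inE => /or3P[]/eqP->; rewrite ?group1 ?groupV.
by rewrite !inE -orbA => /or3P[]/eqP; [constructor 1|constructor 2|constructor 3].
Qed.

(** The commutator is [c ^+ 3] or its inverse; replacing [v] by [v^-1] exchanges the two. *)
Lemma der3_conj u v : u * v != v * u ->
  exists2 v', v' = v \/ v' = v^-1 & v'^-1 * u * v' = c ^+ 3 * u.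
Proof.
move=> nuv; have Dk : [~ u, v] \in D by rewrite derg1 mem_commg ?in_setT.
have e : v^-1 * u * v = u * [~ u, v] by rewrite commgEl mulKVg conjgE mulgA.
have cen k : k \in D -> k * u = u * k.
  by move=> /(subsetP DZ)/centerTP->.
case: (der3_cases Dk) => k1.
- by case/eqP: nuv; rewrite -[u * v](mulKVg v) (mulgA v^-1) e k1 mulg1.
- by exists v; [left | rewrite e k1 -cen].
exists v^-1; first by right.
rewrite (centerTP _ Zc3 u) invgK; apply: (mulIg (c ^- 3)); rewrite mulgK.
have cV := centerTP _ (groupVr Zc3) v^-1.
by rewrite -mulgA -cV mulgA -(mulgA v) -k1 -e !mulgA mulgV mul1g mulgK.
Qed.

Lemma der3_conj_geod u v : u \in S -> v \in S -> u <> c -> u <> c^-1 ->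
  v^-1 * u * v = c ^+ 3 * u -> geod [:: v^-1; u; v].
Proof.
move=> Su Sv nuc nucV e; rewrite /geodesic /word /= (memSV genS) Su Sv.
by rewrite !ev_cons ev_nil mulg1 mulgA e wlen_central_gen.
Qed.

(** Since [u] does not commute with [c] either, conjugating by [v] or [c], up to inversion, gives
    two shortest words of [c ^+ 3 * u], which must coincide. *)
Lemma der3_noncommute u v : u \in S -> v \in S -> u <> c -> u <> c^-1 ->
  u * v != v * u -> v = c \/ v = c^-1.
Proof.
move=> Su Sv nuc nucV nuv.
have nuc' : u * c != c * u.
  apply/eqP=> cuc; have := geod_gen_commute (n := 3) isT gc Su (esym cuc).
  by case.
have [c' c'c ec] := der3_conj nuc'; have [v' v'v ev'] := der3_conj nuv.
have Sc' : c' \in S by case: c'c => ->.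
have Sv' : v' \in S by case: v'v => ->; rewrite ?(memSV genS).
have gc' := der3_conj_geod Su Sc' nuc nucV ec.
have gv' := der3_conj_geod Su Sv' nuc nucV ev'.
have := geod_uniq geoS gc' gv'; rewrite !ev_cons !ev_nil !mulg1 !mulgA ec ev' => /(_ erefl)[_ e].
rewrite -e in v'v; case: c'c v'v => -> [ev|ev].
- by left.
- by right; rewrite ev invgK.
- by right.
by left; apply: invg_inj.
Qed.

(** If [b ^+ 3 = 1], then [g = c ^+ 3 * b * c] equals both [c^-1 * c^-1 * b] and [b^-1 * c * b^-1],
    so its length is below 3. Appending [c^-1] to a shortest word of [g] gives a shortest word of
    [c ^+ 3 * b], which is [c^-1 b c]; hence [c = c^-1], impossible. *)
Lemma der3_cube_neq1 b : b \in S -> b <> c -> b <> c^-1 ->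
  c^-1 * b * c = c ^+ 3 * b -> b ^+ 3 != 1.
Proof.
move=> Sb nbc nbcV e; apply/eqP=> b3; have cZ := centerTP _ Zc3.
have bc : b * c = c ^+ 4 * b.
  by apply: (mulgI c^-1); rewrite mulgA e mulgA (expgS c 3) mulKg.
pose g := c ^+ 3 * b * c.
have e1 : g = c^-1 * c^-1 * b.
  rewrite /g -mulgA bc mulgA -expgD -invMg; congr (_ * _).
  by apply: (mulgI (c ^+ 2)); rewrite -expgD c9 mulgV.
have e2 : g = b^-1 * c * b^-1.
  have bV : b^-1 = b * b by apply/eqP; rewrite eq_invg_mul -b3.
  have bbc : b * b * c = c ^+ 7 * (b * b).
    rewrite -mulgA bc mulgA (expgSr c 3) (mulgA b) -cZ -(mulgA _ b c) bc.
    by rewrite (mulgA (c ^+ 3)) -(expgD c 3 4) -mulgA.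
  apply: (mulgI b); rewrite /g -(mulgA b^-1) mulKVg mulgA (mulgA b) -cZ.
  rewrite -(mulgA (c ^+ 3)) -(mulgA (c ^+ 3)) bbc bV (mulgA (c ^+ 3)) -(expgD c 3 7).
  by rewrite (expgSr c 9) c9 mul1g.
have lg : wlen g < 3.
  rewrite e1; have SVb : b^-1 \in S by rewrite (memSV genS).
  apply: (collide3 genS geoS SVc SVc Sb SVb Sc SVb); first by rewrite -e1 e2.
  by constructor 1 => /invg_inj/esym.
have gb := der3_conj_geod Sb Sc nbc nbcV e.
have [w gw ew] := geodP genS g; have Sw : all [in S] w := geod_word gw.
have er : ev (rcons w c^-1) = c ^+ 3 * b by rewrite ev_rcons ew /g mulgK.
have gr : geod (rcons w c^-1).
  rewrite /geodesic /word all_rcons Sw /= SVc er wlen_central_gen //.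
  by rewrite size_rcons (geod_size gw) ew.
have := geod_uniq geoS gr gb.
rewrite er !ev_cons ev_nil mulg1 mulgA e => /(_ erefl).
rewrite -[[:: _; _; _]]/(rcons [:: c^-1; b] c) => /rcons_inj[_ cV].
have := geod_nseq_sqr (isT : 1 < 3) gc.
by rewrite -{1}cV mulVg setU11.
Qed.

Hypothesis cubeZ : forall g, g ^+ 3 \in Z.

(** Both [b ^+ 3] and [c ^+ 3 * b ^+ 3] are nontrivial central elements of length at most 3, hence
    cubes of generators with geodesic words. If the second is [e ^+ 3], then [e] commutes with [b]
    and is [b] or [b^-1], or it does not and is [c] or [c^-1]; only [b^-1] survives. *)
Lemma der3_cube_mul b : b \in S -> b <> c -> b <> c^-1 -> b ^+ 3 != 1 ->
  c ^+ 3 * b ^+ 3 * b ^+ 3 = 1.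
Proof.
move=> Sb nbc nbcV nb3.
have len3 g : g \in Z -> g != 1 -> wlen g <= 3 ->
    exists e, [/\ e \in S, geod (nseq 3 e) & g = e ^+ 3].
  move=> Zg ng; have [e [k [Se k0 ge eg]]] := central_power genS geoS Zg ng.
  rewrite eg geod_nseq_wlen // => k3; suff e3 : k = 3 by exists e; rewrite -e3.
  apply/eqP; rewrite eqn_leq k3 dvdn_leq //; apply: dvd3 ge _.
  by rewrite -eg.
have gb : geod (nseq 3 b).
  have Swb : word S (nseq 3 b) by rewrite /word /= Sb.
  have := wlen_le genS Swb; rewrite ev_nseq => /(len3 _ (cubeZ b) nb3)[e [_ ge e3]].
  by rewrite /geodesic Swb ev_nseq e3 geod_nseq_wlen.
have lu := wlen_central_mul geoS (isT : 0 < 3) (leqnn 3) gc Zc3 gb nbc nbcV (leqnn 3).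
have ninj x y : geod (nseq 3 x) -> geod (nseq 3 y) -> x ^+ 3 = y ^+ 3 -> x = y.
  by move=> gx gy /(geod_nseq_inj geoS (isT : 0 < 3) gx gy)[].
have nu : c ^+ 3 * b ^+ 3 != 1.
  rewrite eq_mulgV1 invg1 mulg1 -eq_invg_mul -expgVn; apply/eqP.
  by move/(ninj _ _ (geod_nseqV gc) gb)/esym.
have [e [Se ge eu]] := len3 _ (groupM Zc3 (cubeZ b)) nu lu.
have nc3 := geod_nseq_eq1 (isT : 0 < 3) gc.
have nec : e <> c.
  by move=> ec; case/eqP: nb3; apply: (mulgI (c ^+ 3)); rewrite mulg1 eu ec.
have neb : e <> b.
  by move=> eb; case/eqP: nc3; apply: (mulIg (b ^+ 3)); rewrite mul1g eu eb.
have necV : e <> c^-1.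
  move=> ec; case: nbc; apply: ninj => //; apply: (mulgI (c ^+ 3)).
  rewrite eu ec; apply: (mulgI (c ^+ 3)); rewrite expgVn mulgV -!expgD c9.
  by [].
have [eb|/eqP nebV] := eqVneq e b^-1; first by rewrite eu eb expgVn mulVg.
have [ceb|nceb] := eqVneq (b * e) (e * b).
  by case: (geod_gen_commute (n := 3) isT gb Se ceb).
by case: (der3_noncommute Sb Se nbc nbcV nceb).
Qed.

End DerivedOrder3.
Hypothesis oddZ : odd #|Z|.
Hypothesis ncS : forall a, a \in S -> a \notin Z.
Notation D := ([set: G]^`(1)).

(** Conjugation multiplies [g] by a central commutator, whose power of exponent [#|D|] is
    trivial. *)
Lemma central_der_exp g : D \subset Z -> g ^+ #|D| \in Z.
Proof.
move=> DZ; apply/centerTP=> h.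
have Dk : [~ g, h] \in D by rewrite derg1 mem_commg ?in_setT.
have cgk : commute g [~ g, h] by apply/commute_sym/(centerTP _ (subsetP DZ _ Dk)).
apply/commgP/conjg_fixP; rewrite conjXg -[g ^ h](mulKVg g) -commgEl.
by rewrite expgMn // (expg_cardG Dk) mulg1.
Qed.

(** The minimal length [d] is the prime [#|D|]. It divides the length, at most 4, of a nontrivial
    commutator of two generators, so it is 3. Applying [der3_cube_mul] to [c] and to [c^-1] then
    gives [c ^+ 3 = c ^- 3]. *)
Lemma central_der_false : prime #|D| -> D \subset Z -> False.
Proof.
move=> prD DZ; have D1 : 1 < #|D| := prime_gt1 prD.
have ntZ : Z != 1.
  by apply: contraTneq D1 => Z1; rewrite Z1 in DZ; rewrite (trivgP DZ) cards1.
have [a [d [d1 ga Zad dvda dvd_d]]] := center_wlen_dvd genS geoS oddZ ncS ntZ.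
have Sa := geod_nseqS (ltnW d1) ga.
have dD : d = #|D|.
  by apply/(prime_nt_dvdP prD); [rewrite gtn_eqF | exact: dvda (central_der_exp a DZ)].
rewrite {}dD in dvd_d.
have [v Sv nav] := noncentral_gen (ncS Sa).
have Dk : [~ a, v] \in D by rewrite derg1 mem_commg ?in_setT.
have nk : [~ a, v] != 1 by apply: contraNneq nav => /eqP/commgP->.
have [c [m [Sc m0 gm ek]]] := central_power genS geoS (subsetP DZ _ Dk) nk.
have dm : #|D| %| m by apply: dvd_d gm _; rewrite -ek (subsetP DZ).
have m4 : m <= 4.
  rewrite -(geod_nseq_wlen gm) -ek; have := wlen_commg genS a v.
  by rewrite (wlenS genS Sa) (wlenS genS Sv).
have D3 : #|D| = 3.
  have oD : odd #|D| := dvdn_odd (cardSg DZ) oddZ.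
  have := leq_trans (dvdn_leq m0 dm) m4.
  by case: #|D| prD oD => [|[|[|[|[]]]]].
have m3 : m = 3 by move: dm m4 m0; rewrite D3; case: (m) => [|[|[|[|[|]]]]].
rewrite D3 in dvd_d; rewrite {m m0 dm m4}m3 in gm ek.
rewrite ek in Dk => {v Sv nav nk ek}.
have Zc3 := subsetP DZ _ Dk.
have [v Sv ncv] := noncentral_gen (ncS Sc).
have nvc : v <> c by move=> e; rewrite e eqxx in ncv.
have nvcV : v <> c^-1 by move=> e; rewrite e mulgV mulVg eqxx in ncv.
have [b [Sb nbc nbcV eb]] : exists b, [/\ b \in S, b <> c, b <> c^-1 &
    c^-1 * b * c = c ^+ 3 * b].
  rewrite eq_sym in ncv; have [c' [->|->] ec] := der3_conj D3 DZ gm Dk ncv.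
    by exists v.
  exists v^-1; split; first by rewrite (memSV genS).
  - by move/(canRL invgK).
  - by move/invg_inj.
  by rewrite invgK in ec; exact: conj_inv_swap (centerTP _ Zc3 _) ec.
have cubeZ g : g ^+ 3 \in Z by rewrite -D3 central_der_exp.
have nb3 := der3_cube_neq1 D3 DZ gm Dk Sb nbc nbcV eb.
have e1 := der3_cube_mul D3 DZ dvd_d gm Dk cubeZ Sb nbc nbcV nb3.
have e2 : c^-1 ^+ 3 * b ^+ 3 * b ^+ 3 = 1.
  apply: (der3_cube_mul D3 DZ dvd_d (geod_nseqV gm) _ cubeZ Sb) => //.
    by rewrite expgVn groupV.
  by rewrite invgK.
case/eqP: (der3_neqV D3 gm Dk); rewrite -expgVn.
by apply: (mulIg (b ^+ 3)); apply: (mulIg (b ^+ 3)); rewrite e1 e2.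
Qed.

End CentralDerived.

(** * Commutativity degree *)

Lemma card_commuting_pairs (G : finGroupType) :
  #|[set x : G * G | x.1 * x.2 == x.2 * x.1]| = (\sum_(g : G) #|'C[g]|)%N.
Proof.
transitivity (\sum_(g : G) \sum_(h : G | (g * h == h * g)%g) 1)%N.
  by rewrite pair_big_dep /= -sum1_card; apply: eq_bigl => x; rewrite inE.
apply: eq_bigr => g _; rewrite -sum1_card; apply: eq_bigl => h.
by apply/eqP/cent1P.
Qed.

(** Orbit counting for the conjugation action. *)
Lemma sum_card_cent1 (G : finGroupType) :
  (\sum_(g : G) #|'C[g]| = #|classes [set: G]| * #|G|)%N.
Proof.
have actsG : [acts [set: G], on [set: G] | 'J].
  by apply/subsetP=> x _; rewrite !inE; apply/subsetP=> y _; rewrite !inE.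
have := Frobenius_Cauchy actsG; rewrite cardsT => E.
have -> : classes [set: G] = [set orbit 'J [set: G] x | x in [set: G]].
  by apply: eq_imset => x; rewrite orbitJ.
rewrite -E.
apply: eq_big => [g|g _]; first by rewrite inE.
by rewrite setTI afixJ cent_set1.
Qed.

Lemma four_classes_le (gT : finGroupType) (G : {group gT}) :
  4 * #|classes G| <= #|G| + 3 * #|G : G^`(1)|.
Proof.
pose n (i : Iirr G) := irr_degree (socle_of_Iirr i).
have sumn : \sum_i n i ^ 2 = #|G|.
  apply/eqP; rewrite -(Num.Theory.eqr_nat algC) -irr_sum_square GRing.natr_sum.
  by apply/eqP/eq_bigr => i _; rewrite GRing.natrX irr1_degree.
have n_gt0 i : 0 < n i by rewrite -(Num.Theory.ltr_nat algC) -irr1_degree irr1_gt0.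
have n_lin i : n i = 1%N -> ('chi_i \is a linear_char)%R.
  by move=> n1; rewrite qualifE /= irr_char irr1_degree -/(n i) n1 eqxx.
have -> : #|classes G| = (\sum_(i : Iirr G) 1)%N by rewrite sum1_card card_ord NirrE.
rewrite -card_lin_irr -sumn -sum1_card !big_distrr /=.
rewrite [X in _ <= _ + X]big_mkcond -big_split /=; apply: leq_sum => i _.
have := n_gt0 i; case: ifP => [|nl] ; first by rewrite inE; lia.
have : n i <> 1%N by move/n_lin => l; rewrite inE l in nl.
by case: (n i) => [|[|k]] //; rewrite -mulnn; lia.
Qed.

(** With [k] classes and [i] the index of the derived subgroup, [11 * #|G| < 32 * k] and
    [4 * k <= #|G| + 3 * i] give [#|G| < 8 * i]. *)
Lemma card_der1_lt8 (G : finGroupType) :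
  11 * #|G| ^ 2 < 32 * #|[set x : G * G | (x.1 * x.2 == x.2 * x.1)%g]| ->
  #|[set: G]^`(1)%g| < 8.
Proof.
rewrite card_commuting_pairs sum_card_cent1 => h.
have := four_classes_le [set: G]%G; have := Lagrange (der_sub 1 [set: G]%G).
rewrite cardsT => L k4; have G0 : 0 < #|G| by apply/card_gt0P; exists 1%g.
have {}h : 11 * #|G| < 32 * #|classes [set: G]|.
  by rewrite -(ltn_pmul2r G0) -mulnA mulnn -mulnA.
have i0 : 0 < #|[set: G] : [set: G]^`(1)|%g by [].
rewrite -(ltn_pmul2r i0) L; move: h k4 {L}.
move: #|_ : _| #|classes _| #|G| => i k n. lia.
Qed.

(** The conjugates of a generator of [K] lie among its nontrivial elements. *)
Lemma index_cent_prime (gT : finGroupType) (G K : {group gT}) :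
  K <| G -> prime #|K| -> #|G : 'C_G(K)| < #|K|.
Proof.
move=> nKG prK; have /cyclicP[a Ka] := prime_cyclic prK.
have aK : a \in K by rewrite Ka cycle_id.
have na : a != 1 by rewrite -cycle_eq1 -Ka trivg_card1 gtn_eqF ?prime_gt1.
have -> : 'C_G(K) = 'C_G[a] by rewrite Ka cent_cycle.
rewrite index_cent1 [X in _ < X](cardsD1 1) group1 ltnS.
apply: subset_leq_card; apply/subsetP=> _ /imsetP[g Gg ->].
by rewrite !inE conjg_eq1 na memJ_norm // (subsetP (normal_norm nKG)).
Qed.

Lemma normal2_central (gT : finGroupType) (G K : {group gT}) :
  K <| G -> #|K| = 2 -> K \subset 'Z(G).
Proof.
move=> nKG K2; have := index_cent_prime nKG; rewrite K2 => /(_ isT).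
rewrite ltnS leq_eqVlt ltnNge indexg_gt0 orbF indexg_eq1 subsetI => /andP[_ cGK].
by rewrite subsetI (normal_sub nKG) centsC.
Qed.

(* Used with [z = #|Z|], [z + s = #|C|], [z + s + r = #|G|] and [n = #|G'|], where
   [C] is the centraliser of [G'] and [N] the number of commuting pairs. *)
Lemma counting_bound (z s r n N : nat) : 4 <= n -> 3 * (z + s) <= z + s + r -> z * n <= z + s ->
  (N * n = (z * (z + s + r) + s * (z + s)) * n + r * (z + s + r))%N ->
  3 * N <= (z + s + r) ^ 2.
Proof.
move=> n4 cg zn E; set c := (z + s)%N in E cg zn *.
have E1 : N * n <= (c * r + c * c * n + r * c + r * r)%N.
  have : (z * n) * r <= c * r by rewrite leq_mul2r zn orbT.
  have -> : (N * n = z * n * r + c * c * n + r * c + r * r)%N.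
    by rewrite E /c; ring.
  lia.
have r2 : 2 * c <= r by lia.
have c9 : 9 * (c * c) <= (c + r) * (c + r) by nia.
have n0 : 0 < n by lia.
have [k ek] : exists k, n = k.+1 by exists n.-1; lia.
have k3 : 3 <= k by lia.
rewrite -mulnn -(leq_pmul2r n0).
set g := ((c + r) * (c + r))%N in c9 *.
have ck : 9 * (c * c * k) <= g * k by rewrite mulnA leq_mul2r c9 orbT.
have gk : 3 * g <= g * k by rewrite mulnC leq_mul2l k3 orbT.
(* As [N * n <= g + c * c * k], the bounds [ck] and [gk] suffice. *)
have eg : (c * r + r * c + r * r + c * c = g)%N by rewrite /g; ring.
move: E1; rewrite -(mulnA 3); move: (N * n)%N => P; rewrite {}ek !mulnS.
clear c9; clearbody g.
move: g (c * c)%N (c * r)%N (r * c)%N (r * r)%N (c * c * k)%N (g * k)%N ck gk eg.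
by clear; lia.
Qed.

(** * Fixed-point-free action on an abelian derived subgroup *)

Section Frobenius.

Variable G : finGroupType.
Implicit Types (x y g : G).
Notation D := ([set: G]^`(1))%G.
Notation C := ('C(D))%G.
Notation Z := 'Z([set: G]).
Hypotheses (abD : abelian D) (nDC : ~~ (D \subset Z)).
Hypothesis fpf : forall x, x \notin C -> 'C_D[x] = 1.

(** The class of [x] lies in a coset of [D], which gives one inequality; the other holds because
    ['C[x]] meets [D] trivially. *)
Lemma card_cent1_der x : x \notin C -> (#|'C[x]| * #|D| = #|G|)%N.
Proof.
move=> nCx; have ti : 'C[x] :&: D = 1 by rewrite setIC fpf.
have le : #|G| <= #|'C[x]| * #|D|.
  have := LagrangeI [set: G]%G 'C[x]%G; rewrite setTI -indexgI index_cent1 cardsT => <-.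
  rewrite leq_mul2l -(card_lcoset D x); apply/orP; right.
  apply: subset_leq_card; apply/subsetP=> _ /imsetP[g _ ->].
  by rewrite mem_lcoset -commgEl /= derg1 mem_commg ?in_setT.
by apply/eqP; rewrite eqn_leq le andbT -TI_cardMg // -cardsT subset_leq_card ?subsetT.
Qed.

Lemma der_cent1_mul x : x \notin C -> D * 'C[x] = [set: G].
Proof.
move=> nCx; apply/eqP; rewrite eqEcard subsetT TI_cardMg ?fpf //.
by rewrite mulnC card_cent1_der // cardsT leqnn.
Qed.

(** Commutators of elements of ['C[x]] lie in ['C_D[x]]. *)
Lemma cent1_abelian x : x \notin C -> abelian 'C[x].
Proof.
move=> nCx; rewrite /abelian (sameP commG1P eqP) -subG1 -(fpf nCx).
rewrite subsetI; apply/andP; split; last exact: der1_subG.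
by rewrite /= derg1 commgSS ?subsetT.
Qed.

Lemma noncent_ex : exists x, x \notin C.
Proof.
have: ~~ ([set: G] \subset C).
  by apply: contra nDC => sGC; rewrite subsetI subsetT centsC.
by case/subsetPn=> x _; exists x.
Qed.

(** By the modular law, [C] is the product of [D] and an abelian subgroup that centralises [D]. *)
Lemma cent_der_abelian : abelian C.
Proof.
have [x nCx] := noncent_ex.
have -> : C = (D * ('C[x] :&: C))%g :> {set G}.
  by rewrite group_modl // der_cent1_mul // setTI.
rewrite abelianM abD subIset ?subxx ?orbT // andbT.
by apply: abelianS (subsetIl _ _) (cent1_abelian nCx).
Qed.

(** If some [x] outside [C] commutes with [c], then [c] is centralised by [D] and by the abelian
    group ['C[x]], whose product is the whole group. *)
Lemma cent1_noncentral c : c \in C -> c \notin Z -> 'C[c] = C.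
Proof.
move=> Cc nZc; apply/eqP; rewrite eqEsubset; apply/andP; split; last first.
  by rewrite sub_cent1; apply: (subsetP cent_der_abelian).
apply/subsetP=> x cxc; apply: contraR nZc => nCx.
rewrite inE in_setT -(der_cent1_mul nCx) centM inE Cc.
apply: (subsetP (cent1_abelian nCx)).
by rewrite cent1C.
Qed.

Lemma card_center_der : #|Z| * #|D| <= #|C|.
Proof.
have [x nCx] := noncent_ex.
rewrite -TI_cardMg.
  have ZC : Z \subset C.
    by apply: subset_trans (subsetIr _ _) _; exact: centS (subsetT _).
  by rewrite subset_leq_card // mul_subG.
apply/trivgP; rewrite -(fpf nCx) subsetI subsetIr /=.
apply: subset_trans (subsetIl _ _) _.
by apply: subset_trans (subsetIr _ _) _; rewrite -cent_set1 centS // subsetT.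
Qed.

(** Centralisers have order [#|G|] on [Z], [#|C|] on the rest of [C], and [#|G| / #|D|] outside; the
    factor [#|D|] avoids the division. *)
Lemma sum_card_cent1_fpf : ((\sum_(g : G) #|'C[g]|) * #|D| =
  (#|Z| * #|G| + (#|C| - #|Z|) * #|C|) * #|D| + (#|G| - #|C|) * #|G|)%N.
Proof.
have ZC : Z \subset C.
  by apply: subset_trans (subsetIr _ _) _; exact: centS (subsetT _).
have ZCI : [set: G] :&: Z = Z by rewrite setTI.
rewrite (bigID (mem C)) /= mulnDl; congr (_ + _)%N.
  congr (_ * _)%N; rewrite (bigID (mem Z)) /=; congr (_ + _)%N.
    rewrite -sum_nat_const; apply: eq_big => [g|g /andP[_ Zg]].
      by apply: andb_idl; apply: (subsetP ZC).
    rewrite -cardsT; congr #|pred_of_set _|; apply/eqP.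
    by rewrite eqEsubset subsetT sub_cent1; move: Zg; rewrite inE in_setT.
  have -> : (#|C| - #|Z|)%N = #|C :\: Z| by rewrite cardsD (setIidPr ZC).
  rewrite -sum_nat_const; apply: eq_big => [g|g /andP[Cg nZg]].
    by rewrite [RHS]inE andbC.
  by rewrite cent1_noncentral.
have -> : (#|G| - #|C|)%N = #|~: C| by rewrite [RHS]cardsCs setCK.
rewrite big_distrl /= -sum_nat_const; apply: eq_big => [g|g nCg].
  by rewrite [RHS]inE.
exact: card_cent1_der.
Qed.

Lemma fpf_commuting_bound : 3 <= #|[set: G] : C| -> 4 <= #|D| ->
  3 * (\sum_(g : G) #|'C[g]|) <= #|G| ^ 2.
Proof.
move=> m3 n4; have := sum_card_cent1_fpf; have := card_center_der.
have: 3 * #|C| <= #|G|.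
  by rewrite -cardsT -(Lagrange (subsetT C)) mulnC leq_mul2l m3 orbT.
have: #|Z| <= #|C|.
  apply/subset_leq_card/(subset_trans (subsetIr _ _)).
  exact: centS (subsetT _).
move: (\sum_g _)%N n4; move: #|Z| #|C| #|D| #|G| => z c n g N n4 zc cg zn.
have [s ec] : exists s, c = (z + s)%N by exists (c - z)%N; lia.
have [r eg] : exists r, g = (c + r)%N by exists (g - c)%N; lia.
subst g c; rewrite (_ : z + s - z = s)%N; last by rewrite addKn.
rewrite (_ : z + s + r - (z + s) = r)%N; last by rewrite addKn.
exact: counting_bound.
Qed.

End Frobenius.

Lemma card_lt3_abelian (gT : finGroupType) (H : {group gT}) :
  #|H| < 3 -> abelian H.
Proof.
have := cardG_gt0 H; case E : #|H| => [|[|[|k]]] // _ _.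
  by rewrite (card1_trivg E) abelian1.
by rewrite cyclic_abelian // prime_cyclic ?E.
Qed.

(** * Derived subgroups of order less than eight *)

Section SmallDerived.

Variable G : finGroupType.
Notation D := ([set: G]^`(1))%G.
Notation C := ('C(D))%G.
Notation Z := 'Z([set: G]).
Hypothesis oddZ : odd #|Z|.

Lemma no_normal2 (K : {group G}) : K <| [set: G] -> #|K| <> 2.
Proof.
move=> nK K2; have := cardSg (normal2_central nK K2).
by rewrite K2 dvdn2 oddZ.
Qed.

(** The Sylow 3-subgroup [Q] is normal in the group and its centraliser has index at most two, so
    [D] centralises [Q]. As [D / Q] is cyclic, [D] is abelian, and its 2-core is a normal subgroup
    of order two. *)
Lemma card_der_neq6 : #|D| <> 6.
Proof.
move=> D6; have [Q sylQ] := Sylow_exists 3 D.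
have Q3 : #|Q| = 3 by rewrite (card_Hall sylQ) D6 p_part.
have sQD := pHall_sub sylQ.
have iQ : #|D : Q| = 2 by rewrite -divgS // D6 Q3.
have nQD := index2_normal sQD iQ.
have nQG : Q <| [set: G].
  rewrite -(normal_Hall_pcore sylQ nQD).
  exact: char_normal_trans (pcore_char _ _) (der_normal 1 [set: G]).
have prQ : prime #|Q| by rewrite Q3.
have := index_cent_prime nQG prQ; rewrite setTI Q3 => lt3.
have nCQ : 'C(Q) <| [set: G] by rewrite /normal subsetT norms_cent ?normal_norm.
have sDC : D \subset 'C(Q).
  apply: der1_min; first exact: normal_norm nCQ.
  by apply: card_lt3_abelian; rewrite card_quotient ?normal_norm.
have abD : abelian D.
  apply: (@cyclic_factor_abelian _ Q); first by rewrite subsetI sQD centsC.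
  by rewrite prime_cyclic // card_quotient ?normal_norm // iQ.
have hall2 := nilpotent_pcore_Hall 2 (abelian_nil abD).
have nO2 : 'O_2(D) <| [set: G] by exact: char_normal_trans (pcore_char _ _) (der_normal 1 [set: G]).
by apply: (no_normal2 nO2); rewrite (card_Hall hall2) D6 p_part.
Qed.

(** Conjugates of [x] differ from it by elements of the abelian group [D], so ['C_D[x]] is normal.
    Its order divides 4, is not 2 by [no_normal2], and is not 4 as [x] is outside [C]. *)
Lemma der4_fpf x : #|D| = 4 -> x \notin C -> 'C_D[x] = 1.
Proof.
move=> D4 nCx; have abD : abelian D by apply: (@card_p2group_abelian _ 2).
have nK : 'C_D[x] <| [set: G].
  rewrite /normal subsetT; apply/subsetP=> y _; rewrite inE.
  apply/subsetP=> _ /imsetP[d /setIP[Dd /cent1P cdx] ->].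
  have Dy : d ^ y \in D by rewrite memJ_norm // (subsetP (normal_norm (der_normal 1 [set: G]))) ?inE.
  rewrite inE Dy; apply/cent1P.
  have -> : x = x ^ y * [~ x, y]^-1 by rewrite commgEl invMg invgK mulKVg.
  apply: commuteM; first by rewrite /commute -!conjMg cdx.
  apply: (centsP abD) => //; rewrite groupV /= derg1 mem_commg ?in_setT //.
have : #|'C_D[x]| %| 4 by rewrite -D4 cardSg ?subsetIl.
have ne4 : #|'C_D[x]| <> 4.
  move=> c4; case/negP: nCx; have: D \subset 'C[x].
    by apply/setIidPl/eqP; rewrite eqEcard subsetIl c4 D4.
  by rewrite sub_cent1.
have ne2 := no_normal2 nK.
have := cardG_gt0 'C_D[x]; case E : #|_| => [|[|[|[|[|k]]]]] // _.
by move=> _; apply: card1_trivg.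
Qed.

Lemma prime_der_fpf x : prime #|D| -> x \notin C -> 'C_D[x] = 1.
Proof.
move=> prD nCx; apply: prime_TIg => //.
by rewrite sub_cent1.
Qed.

Lemma commuting_cases :
  11 * #|G| ^ 2 < 32 * #|[set x : G * G | (x.1 * x.2 == x.2 * x.1)%g]| ->
  [\/ abelian [set: G], prime #|D| /\ D \subset Z |
      exists A : {group G}, abelian A /\ #|[set: G] : A| = 2].
Proof.
move=> h; have := card_der1_lt8 h.
have [DZ|nDZ] := boolP (D \subset Z).
  move=> D8; have oD := dvdn_odd (cardSg DZ) oddZ.
  case E : #|D| (cardG_gt0 D) D8 oD => [|[|[|[|[|[|[|[|]]]]]]]] // _ _ _.
  - constructor 1; apply/derG1P; exact: card1_trivg E.
  - by constructor 2.
  - by constructor 2.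
  by constructor 2.
move=> D8; have D1 : #|D| <> 1%N.
  by move=> D1; rewrite (card1_trivg D1) sub1G in nDZ.
have [[abD fpf] D3] : (abelian D /\ forall x, x \notin C -> 'C_D[x] = 1) /\ 3 <= #|D|.
  have D6 := card_der_neq6; have D2 := no_normal2 (der_normal 1 [set: G]).
  have [D4|D4] := eqVneq #|D| 4.
    split; last by rewrite D4.
    split=> [|x]; [exact: (@card_p2group_abelian _ 2) | exact: der4_fpf].
  have prD : prime #|D|.
    by move: D8 D1 D2 D6 D4 (cardG_gt0 D); case: #|D| => [|[|[|[|[|[|[|[|]]]]]]]].
  split; first by split=> [|x]; [exact/cyclic_abelian/prime_cyclic | exact: prime_der_fpf].
  by rewrite ltn_neqAle prime_gt1 // andbT; apply/eqP=> /esym.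
have [m3|] := leqP 3 #|[set: G] : C|; last first.
  rewrite ltnS leq_eqVlt => /orP[/eqP C2|].
    by constructor 3; exists C; split=> //; exact: cent_der_abelian abD nDZ fpf.
  rewrite ltnS leq_eqVlt ltnNge indexg_gt0 orbF indexg_eq1 => sGC.
  by case/negP: nDZ; rewrite subsetI subsetT centsC.
(* Order 3 would force the index of [C] below 3. *)
have n4 : 4 <= #|D|.
  rewrite ltn_neqAle D3 andbT; apply/eqP=> /esym D_3.
  have := @index_cent_prime _ [set: G]%G D (der_normal 1 [set: G]).
  by rewrite setTI D_3 ltnNge m3 => /(_ isT).
(* This bounds the commutativity degree by 1/3, which is less than 11/32. *)
have := fpf_commuting_bound abD nDZ fpf m3 n4.
rewrite -card_commuting_pairs; move: h; move: #|_| (#|G| ^ 2)%N => N g; lia.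
Qed.

End SmallDerived.

(** * Odd cycles and the conclusion *)

Lemma center_cycle_odd (G : finGroupType) (S : {set G}) (z : G) :
  generating_set S -> odd #|'Z([set: G])| -> z \in S -> S \subset [set z; z^-1] ->
  odd_cycle_graph (cayley S).
Proof.
move=> genS oddZ Sz sSz; have Gz : [set: G] = <[z]>.
  apply/eqP; rewrite eqEsubset subsetT andbT; case: (genS) => _ _ <-.
  rewrite gen_subG (subset_trans sSz) //.
  by apply/subsetP=> x /set2P[]->; rewrite ?groupV cycle_id.
have eS : S = [set z; z^-1].
  apply/eqP; rewrite eqEsubset sSz; apply/subsetP=> x /set2P[]->//.
  by rewrite (memSV genS).
have oz : #|G| = #[z] by rewrite -cardsT Gz.
(* A cyclic group is its own centre, so the order of [z] is that of the centre. *)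
have odd_z : odd #[z].
  by move: oddZ; rewrite (center_idP _) ?cardsT ?oz // Gz cycle_abelian.
have z1 := memS_neq1 genS Sz.
pose f (i : 'I_#[z]) := z ^+ i.
have f_inj : injective f.
  move=> i j /eqP; rewrite /f eq_expg_mod_order !modn_small // => /eqP.
  exact: val_inj.
exists #[z]; split=> //.
  by move: z1 odd_z; rewrite -order_gt1; case: #[z] => [|[|[]]].
exists f; split; first by apply: inj_card_bij f_inj _; rewrite card_ord oz.
have fS i : f (ordS i) = f i * z by rewrite /f /= expg_mod_order expgSr.
move=> i j; rewrite cayleyE eS in_set2 -!(inj_eq f_inj) !fS; congr (_ || _).
  by rewrite -(inj_eq (mulgI (f i))) mulKVg.
rewrite -(inj_eq (mulgI (f i))) mulKVg -(inj_eq (mulIg z)) mulgKV.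
exact: eq_sym.
Qed.

Lemma commutativity_degree_gt (G : finGroupType) :
  (11%:R / 32%:R < commutativity_degree G)%R ->
  11 * #|G| ^ 2 < 32 * #|[set x : G * G | (x.1 * x.2 == x.2 * x.1)%g]|.
Proof.
have G0 : 0 < #|G| by apply/card_gt0P; exists 1%g.
rewrite /commutativity_degree cardsT Num.Theory.ltr_pdivlMr.
  rewrite GRing.mulrAC Num.Theory.ltr_pdivrMr // -!GRing.natrM Num.Theory.ltr_nat.
  by rewrite [X in _ < X]mulnC.
by rewrite Num.Theory.ltr0n expn_gt0 G0.
Qed.

Local Close Scope group_scope.

Theorem theorem3 (G : finGroupType)
  (hG : [\/ ~~ odd #|'Z([set: G])%g|,
            exists A : {group G}, abelian A /\ #|[set: G] : A|%g = 2,
            [/\ nilpotent [set: G], ~~ cyclic [set: G] &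
                forall p : nat, prime p -> odd p ->
                  p < 3 * 2 ^ (nil_class [set: G] - 1) - 2 ->
                  ~~ (p %| exponent [set: G] %/ exponent 'Z([set: G])%g)]
          | (11%:R / 32%:R < commutativity_degree G)%R])
  (Sigma : {set G}) (hSigma : generating_set Sigma)
  (hgeo : geodetic (cayley Sigma)) :
  complete_graph (cayley Sigma) \/ odd_cycle_graph (cayley Sigma).
Proof.
have [oddZ|evZ] := boolP (odd #|'Z([set: G])%g|); last first.
  by left; apply: closed_complete => //; exact: even_center_closed.
have [[z Sz Zz]|ncS] : (exists2 z, z \in Sigma & z \in 'Z([set: G])%g) \/
    (forall z, z \in Sigma -> z \notin 'Z([set: G])%g).
- have [/exists_inP|/exists_inPn] := boolP [exists z in Sigma, z \in 'Z([set: G])%g].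
    by left.
  by right.
- case: (central_gen_closed hSigma hgeo Sz Zz) => [/(closed_complete hSigma)|sSz]; first by left.
  by right; apply: center_cycle_odd sSz.
left; apply: closed_complete => //.
case: hG => [|[A [abA iA]]|[nilG ncyc hp]|/commutativity_degree_gt/(commuting_cases oddZ)].
- by rewrite oddZ.
- exact: index2_closed abA iA.
- by case: (nilpotent_false hSigma hgeo oddZ ncS nilG ncyc hp).
case=> [abG|[prD DZ]|[A [abA iA]]].
(* In an abelian group no element is noncentral, so [ncS] contradicts the presence of [a]. *)
- by move=> a b /ncS; rewrite (center_idP abG) inE.
- by case: (central_der_false hSigma hgeo oddZ ncS prD DZ).
exact: index2_closed abA iA.
Qed.
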